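(* Let $m,p,n$ be positive integers with $p\mid m$ and let $g\in G(m,p,n)$. The number of Hurwitz orbits of shortest reflection factorizations of $g$ is $$\sum_{\Pi\in\operatorname{Par}_{\max}(g)}\ \prod_{B\in\Pi} r(B)^{|B|-1},$$ where $|B|$ denotes the number of cycles of $g$ contained in the part $B$.
   Context: Let $\omega=\exp(2\pi i/m)$. $G(m,p,n)$ is the group of $n\times n$ complex monomial matrices (exactly one nonzero entry in each row and column) whose nonzero entries are $m$th roots of unity with product an $(m/p)$th root of unity. An element is written $g=[u;(a_1,\ldots,a_n)]$ with $u=\pi(g)\in\mathfrak S_n$ (the underlying permutation) and $a_j\in\mathbb Z/m\mathbb Z$, meaning that the nonzero entry of column $j$ is $\omega^{a_j}$, in row $u(j)$. The weight of a subset $S\subseteq\{1,\ldots,n\}$ in $g$ is $\sum_{j\in S}a_j\in\mathbb Z/m\mathbb Z$; the weight of $g$ is $a_1+\cdots+a_n$, and it lies in $p\mathbb Z/m\mathbb Z$. A cycle of $g$ is a cycle of $\pi(g)$ (fixed points count as cycles), and its weight is the weight of its support. A reflection of $G(m,p,n)$ is an element whose fixed space in $\mathbb C^n$ is a hyperplane. A reflection factorization of $g$ is a tuple $(t_1,\ldots,t_\ell)$ of reflections in $G(m,p,n)$ with $t_1\cdots t_\ell=g$; it is shortest if $\ell$ is minimum possible. The Hurwitz action of the braid group on $\ell$ strands on $\ell$-tuples is generated by the moves $\sigma_i$ that replace $(t_i,t_{i+1})$ by $(t_{i+1},\,t_{i+1}^{-1}t_it_{i+1})$ and leave the other entries unchanged;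 Hurwitz orbits are the orbits of this action. A cycle partition $\Pi$ of $g$ is a set partition of the set of cycles of $g$ such that in each part the cycle weights sum to $0$ modulo $p$. Its value is $v(\Pi)=|\Pi|+v_m(\Pi)$, where $|\Pi|$ is the number of parts and $v_m(\Pi)$ is the number of parts whose total weight is $0$ in $\mathbb Z/m\mathbb Z$. $\operatorname{Par}_{\max}(g)$ is the set of cycle partitions of $g$ of maximum value. For a part $B$ whose cycles have weights $k_1,\ldots,k_{|B|}$, $r(B)=\gcd(m,k_1,\ldots,k_{|B|})$ (computed from any integer representatives of the $k_i$). *)

(* Defs.v *)
From mathcomp Require Import all_boot all_order all_algebra all_fingroup.
From mathcomp Require Import complex.
From mathcomp Require Import all_classical reals trigo.

Set Implicit Arguments.
Unset Strict Implicit.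
Unset Printing Implicit Defensive.

Import Order.TTheory GRing.Theory Num.Theory.
Local Open Scope ring_scope.

Section ComplexReflectionGroups.
Variables (R : realType) (m p n : nat).

Notation C := R[i].
Notation mx := 'M[C]_n.

Definition omega : C :=
  Complex (cos (2 * pi / m%:R : R)) (sin (2 * pi / m%:R : R)).

Definition monomial (g : mx) : bool :=
  [forall i, #|[pred j | g i j != 0]| == 1%N] &&
  [forall j, #|[pred i | g i j != 0]| == 1%N].

Definition Gmpn (g : mx) : bool :=
  [&& monomial g,
      [forall i, forall j, (g i j != 0) ==> (g i j ^+ m == 1)] &
      (\prod_i \prod_(j | g i j != 0) g i j) ^+ (m %/ p) == 1].

(* [monomial_perm g] and [exponent g] are the [u] and [a] of the notation
   [g = [u; (a_1, ..., a_n)]]; the default values are not used when [Gmpn g]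
   holds, see [monomial_formE] below. *)
Definition monomial_perm (g : mx) : 'S_n :=
  odflt 1%g [pick u : 'S_n | [forall j, g (u j) j != 0]].

(* Elements of Z/mZ are represented by their remainders in [0, m). *)
Definition exponent (g : mx) (j : 'I_n) : nat :=
  oapp (@nat_of_ord m) 0%N
    [pick a : 'I_m | g (monomial_perm g j) j == omega ^+ a].

Lemma omegaX k : omega ^+ k =
  Complex (cos (2 * pi / m%:R *+ k : R)) (sin (2 * pi / m%:R *+ k : R)).
Proof.
elim: k => [|k IHk]; first by rewrite expr0 !mulr0n cos0 sin0.
rewrite exprS IHk [_ *+ k.+1]mulrS cosD sinD /omega; congr Complex.
by rewrite addrC.
Qed.

Lemma omega_prim : (0 < m)%N -> m.-primitive_root omega.
Proof.
move=> m_gt0; have m_gt0R : 0 < m%:R :> R by rewrite ltr0n.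
apply/andP; split=> //; apply/forallP => k; rewrite unity_rootE omegaX.
pose t : R := pi * k.+1%:R / m%:R.
have -> : 2 * pi / m%:R *+ k.+1 = t *+ 2 :> R.
  by rewrite -[LHS]mulr_natr -[RHS]mulr_natl /t !mulrA -!mulrA [_^-1 * _]mulrC.
apply/eqP; have [km|ne_km] := eqVneq k.+1 m.
  have m_neq0 : m%:R != 0 :> R by rewrite gt_eqF.
  rewrite /t km mulfK // cos_mulr2n sin_mulr2n cospi sinpi.
  by rewrite mulr0 mul0rn sqrrN expr1n mulr2n addrK; apply/eqP.
apply/negbTE/eqP => -[+ _].
have t_gt0 : 0 < t by rewrite divr_gt0 // mulr_gt0 ?pi_gt0 ?ltr0n.
have t_ltpi : t < pi.
  rewrite ltr_pdivrMr // ltr_pM2l ?pi_gt0 // ltr_nat ltn_neqAle.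
  by rewrite ne_km ltn_ord.
have st : 0 < sin t by rewrite sin_gt0_pi // t_gt0.
move/eqP; rewrite cos_mulr2n cos2sin2 subr_eq -mulr2n eqr_pMn2r //.
by rewrite -subr_eq0 addrC addKr oppr_eq0 expf_eq0 gt_eqF.
Qed.

Lemma monomial_permP (g : mx) :
  monomial g -> forall i j, (g i j != 0) = (i == monomial_perm g j).
Proof.
case/andP=> /forallP rowg /forallP colg.
have [f fP] : exists f : 'I_n -> 'I_n, forall i j, (g i j != 0) = (i == f j).
  have ex j : exists i, forall i', (g i' j != 0) = (i' == i).
    by have /fintype.card1P[i gi] := colg j; exists i => i'; have := gi i'.
  exists (fun j => projT1 (cid (ex j))) => i j.
  by case: cid => /= i' ->.
have f_inj : injective f.
  move=> j1 j2 f12; have /fintype.card1P[j gj] := rowg (f j1).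
  have := gj j1; have := gj j2; rewrite !inE !fP f12 eqxx.
  by move=> /esym/eqP-> /esym/eqP->.
rewrite /monomial_perm; case: pickP => [u /forallP gu i j|/(_ (perm f_inj))].
  by have := gu j; rewrite !fP => /eqP->.
by move=> /forallP[] j; rewrite fP permE.
Qed.

Lemma monomial_formE (g : mx) : (0 < m)%N -> Gmpn g ->
  g = \matrix_(i, j)
        if i == monomial_perm g j then omega ^+ exponent g j else 0.
Proof.
move=> m_gt0 /and3P[/monomial_permP g0 /forallP gm _]; apply/matrixP => i j.
rewrite mxE; have := g0 i j; case: (i =P _) => [->|_]; last by move/negbFE/eqP.
move=> gj; rewrite /exponent; case: pickP => [a /eqP //|].
have /forallP/(_ j) := gm (monomial_perm g j); rewrite gj => /eqP gXm.
by have [a ->] := prim_rootP (omega_prim m_gt0) gXm => /(_ a); rewrite eqxx.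
Qed.
Definition weight (g : mx) (S : {set 'I_n}) : nat :=
  ((\sum_(j in S) exponent g j) %% m)%N.

Definition cycles (g : mx) : {set {set 'I_n}} := porbits (monomial_perm g).

(* [eigenspace] is about row vectors, hence the transpose: its rows span the
   column vectors fixed by [t]. *)
Definition reflection (t : mx) : bool :=
  Gmpn t && ((\rank (eigenspace t^T 1)).+1 == n).

Definition factorization (g : mx) (ts : seq mx) : bool :=
  all reflection ts && (\big[mulmx/1%:M]_(t <- ts) t == g).

Definition shortest_factorization (g : mx) (ts : seq mx) : Prop :=
  factorization g ts /\
  forall ts', factorization g ts' -> (size ts <= size ts')%N.

(* [hurwitz i] acts on the entries of ranks [i] and [i.+1] (counted from 0), and
   is the identity if there are no such entries. *)
Fixpoint hurwitz (i : nat) (ts : seq mx) : seq mx :=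
  match i, ts with
  | 0%N, t1 :: t2 :: ts' => t2 :: invmx t2 *m t1 *m t2 :: ts'
  | i'.+1, t1 :: ts' => t1 :: hurwitz i' ts'
  | _, _ => ts
  end.

Fixpoint hurwitz_inv (i : nat) (ts : seq mx) : seq mx :=
  match i, ts with
  | 0%N, t1 :: t2 :: ts' => t1 *m t2 *m invmx t1 :: t1 :: ts'
  | i'.+1, t1 :: ts' => t1 :: hurwitz_inv i' ts'
  | _, _ => ts
  end.

Lemma hurwitzK i ts :
  all [in unitmx] ts -> hurwitz_inv i (hurwitz i ts) = ts.
Proof.
elim: i ts => [|i IHi] [|t1 ts] //=; last by case/andP=> _ /IHi ->.
case: ts => [|t2 ts] //= /and3P[_ ? _].
by rewrite !mulmxA mulmxV // mul1mx mulmxK.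
Qed.

Lemma hurwitz_invK i ts :
  all [in unitmx] ts -> hurwitz i (hurwitz_inv i ts) = ts.
Proof.
elim: i ts => [|i IHi] [|t1 ts] //=; last by case/andP=> _ /IHi ->.
case: ts => [|t2 ts] //= /andP[? _].
by rewrite -!mulmxA mulVmx // mulmx1 mulKmx.
Qed.

(* A braid is given by a word in the generators, where [(i, false)] stands for
   the generator of index [i] and [(i, true)] for its inverse. *)
Definition braid_act (w : seq (nat * bool)) (ts : seq mx) : seq mx :=
  foldr (fun x => if x.2 then hurwitz_inv x.1 else hurwitz x.1) ts w.

Definition hurwitz_orbit (ts : seq mx) : set (seq mx) :=
  [set braid_act w ts | w in setT]%classic.

Definition hurwitz_orbits (g : mx) : set (set (seq mx)) :=
  [set hurwitz_orbit ts | ts in shortest_factorization g]%classic.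

Definition cycle_partition (g : mx) (P : {set {set {set 'I_n}}}) : bool :=
  finset.partition P (cycles g) &&
  [forall B in P, (p %| \sum_(c in B) weight g c)%N].

Definition value (g : mx) (P : {set {set {set 'I_n}}}) : nat :=
  (#|P| + #|[set B in P | (m %| \sum_(c in B) weight g c)%N]%SET|)%N.

Definition par_max (g : mx) : {set {set {set {set 'I_n}}}} :=
  [set P | cycle_partition g P &
     [forall P', cycle_partition g P' ==> (value g P' <= value g P)%N]]%SET.

Definition part_gcd (g : mx) (B : {set {set 'I_n}}) : nat :=
  \big[gcdn/m]_(c in B) weight g c.

End ComplexReflectionGroups.

(* Main.v *)
Require Import Defs.
From mathcomp Require Import all_boot all_order all_algebra all_fingroup.
From mathcomp Require Import complex.
From mathcomp Require Import all_classical reals.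
From mathcomp Require Import zify.

(** An element [u; a] of G(m,1,n) is seen below as the permutation
    [(x, c) |-> (u x, c + a x)] of the points [(x, c)], where [x] is an index
    and [c] is in Z/m. Its reflections are then the [tr x y c], which exchange
    the fibres above [x] and [y], and the [dg x c], which translate the fibre
    above [x] by a nonzero multiple [c] of p.

    Upper bound. Choose an index [x], and move to the left, by Hurwitz moves,
    the factors of a shortest factorization that do not fix [(x, 0)]. Two
    neighbours among them that send [x] to different indices can be exchanged so
    that only one of the new factors moves [(x, 0)]. When no such exchange is
    left, all of them send [x] to the same index, and because the factorization
    is shortest there are at most two ([peel]). If [x] is not
    fixed by [u] then a single factor remains, and the product determines it.
    Removing it takes [x] out of its cycle; in this way every shortest
    factorization of [u; a] becomes a fixed sequence [T0] followed by a
    shortest factorization of a diagonal element, which acts on one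
    representative of each cycle through the weight of that cycle
    ([cycle_reduction]). For a diagonal element [w], removing [x] costs nothing,
    or one diagonal reflection, or a pair [tr x y c, tr x y d] with
    [c - d = w x], which merges the weight of [x] into that of [y]. By induction
    the factorization becomes a union of stars ([diag_star]): the indices are
    partitioned into blocks, each block has a root [o], every other member [x]
    contributes the pair [tr o x (b x), tr o x (b x + w x)], and the root
    contributes a diagonal reflection when the weight of the block is not zero.
    The length of such a normal form is a constant minus the value of its
    partition ([normal_size]), so that the shortest ones belong to the
    partitions of maximum value.

    Labels. Hurwitz moves inside a star change the labels [b]: exchanging the
    two members of a pair adds [w x] to [b x]; exchanging the pairs of [x] and
    [y] twice adds [w y] to [b x] and [w x] to [b y]; doing so with the diagonal
    reflection of the root subtracts the weight of the block from [b x]. These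
    changes generate all the multiples of the gcd [r] of m and the weights in
    the block ([lat_big_gcdn], [shift_gcd]), hence labels that agree modulo [r]
    give equivalent normal forms.

    Lower bound. Modulo [r] all the weights of a block vanish, so the factors of
    a normal form all preserve the function [potential_class] on the points.
    This property is an invariant of the orbit, and it determines both the
    partition and the labels modulo [r] ([star_inj]). The orbits are thus
    counted by the partitions of maximum value with one residue modulo [r] for
    each member of a block other than its root ([model_count]). Finally the
    matrices of the statement are matched with this model, reflections being
    recognised by the rank of [t - 1] ([rank1_is_reflection]). *)

Set Implicit Arguments.
Unset Strict Implicit.
Unset Printing Implicit Defensive.

(** * Hurwitz moves in a group *)
Section HurwitzEquivalence.
Local Open Scope group_scope.
Variable gT : finGroupType.
Implicit Types (s t h : gT) (T : seq gT).

Inductive hurw : seq gT -> seq gT -> Prop :=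
| hurw_refl T : hurw T T
| hurw_sym T T' : hurw T T' -> hurw T' T
| hurw_trans T T' T'' : hurw T T' -> hurw T' T'' -> hurw T T''
| hurw_swap s t T1 T2 : hurw (T1 ++ s :: t :: T2) (T1 ++ t :: s ^ t :: T2).

Definition conjs T h := [seq t ^ h | t <- T].
Definition prods T := \prod_(t <- T) t.

Lemma prods_cat T1 T2 : prods (T1 ++ T2) = prods T1 * prods T2.
Proof. by rewrite /prods big_cat. Qed.

Lemma prods_cons t T : prods (t :: T) = t * prods T.
Proof. by rewrite /prods big_cons. Qed.

Lemma prods_nil : prods [::] = 1.
Proof. by rewrite /prods big_nil. Qed.

Lemma prods_conjs T h : prods (conjs T h) = prods T ^ h.
Proof.
elim: T => [|t T IH]; first by rewrite /prods !big_nil conj1g.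
by rewrite /= !prods_cons IH conjMg.
Qed.

Lemma conjsM T h h' : conjs (conjs T h) h' = conjs T (h * h').
Proof. by rewrite /conjs -map_comp; apply: eq_map => t /=; rewrite conjgM. Qed.

Lemma conjs1 T : conjs T 1 = T.
Proof. by rewrite /conjs (eq_map (@conjg1 _)) map_id. Qed.

Lemma hurw_size T T' : hurw T T' -> size T = size T'.
Proof. by elim=> // [? ? ? _ -> //|s t T1 T2]; rewrite !size_cat. Qed.

Lemma hurw_prods T T' : hurw T T' -> prods T = prods T'.
Proof.
elim=> // [? ? ? _ -> //|s t T1 T2].
by rewrite !prods_cat !prods_cons conjgE !mulgA mulgK.
Qed.

Lemma hurw_catl T0 T T' : hurw T T' -> hurw (T0 ++ T) (T0 ++ T').
Proof.
elim=> [?|? ? _|? ? ? _ + _|s t T1 T2]; first exact: hurw_refl.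
- exact: hurw_sym.
- exact: hurw_trans.
- by rewrite !catA; apply: hurw_swap.
Qed.

Lemma hurw_catr T0 T T' : hurw T T' -> hurw (T ++ T0) (T' ++ T0).
Proof.
elim=> [?|? ? _|? ? ? _ + _|s t T1 T2]; first exact: hurw_refl.
- exact: hurw_sym.
- exact: hurw_trans.
- by rewrite -!catA; apply: hurw_swap.
Qed.

(** Invariants of Hurwitz orbits come from this lemma: [Q] only has to be stable
    under conjugation by elements that satisfy [Q]. *)
Lemma hurw_all (Q : gT -> Prop) :
    (forall s t, Q s -> Q t -> Q (s ^ t)) ->
    (forall s t, Q s -> Q t -> Q (s ^ t^-1)) ->
  forall T T', hurw T T' ->
    (forall t, t \in T -> Q t) <-> (forall t, t \in T' -> Q t).
Proof.
move=> QJ QJV T T'; elim=> // [? ? _ ->//|? ? ? _ -> _ -> //|s t T1 T2].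
split=> QT r; have := QT t; rewrite !mem_cat !inE eqxx ?orbT => /(_ isT) Qt.
  case/or4P=> [rT1|/eqP->//|/eqP->|rT2].
  - by apply: QT; rewrite mem_cat rT1.
  - by apply: QJ => //; apply: QT; rewrite mem_cat !inE eqxx orbT.
  - by apply: QT; rewrite mem_cat !inE rT2 !orbT.
case/or4P=> [rT1|/eqP->|/eqP->//|rT2].
- by apply: QT; rewrite mem_cat rT1.
- rewrite -[s](conjgK t); apply: QJV => //; apply: QT.
  by rewrite mem_cat !inE eqxx !orbT.
- by apply: QT; rewrite mem_cat !inE rT2 !orbT.
Qed.

(** A factor that jumps over its right neighbour is conjugated by it, so a whole
    block that jumps over [T2] is conjugated by the product of [T2]. *)
Lemma hurw_mover T1 T2 : hurw (T1 ++ T2) (T2 ++ conjs T1 (prods T2)).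
Proof.
have one s T : hurw (s :: T) (T ++ [:: s ^ prods T]).
  elim: T s => [|t T IH] s; first by rewrite prods_nil conjg1; apply: hurw_refl.
  apply: hurw_trans (hurw_swap s t [::] T) _ => /=.
  apply: (@hurw_catl [:: t]) => //=.
  by rewrite prods_cons conjgM; apply: IH.
elim: T1 => [|s T1 IH]; first by rewrite cats0; apply: hurw_refl.
apply: hurw_trans (hurw_catl [:: s] IH) _.
rewrite /= -cat_cons -[_ :: conjs _ _]cat1s catA.
exact: hurw_catr.
Qed.

Lemma hurw_movel T1 T2 : hurw (T1 ++ T2) (conjs T2 (prods T1)^-1 ++ T1).
Proof.
apply: hurw_sym; apply: hurw_trans (hurw_mover _ _) _.
by rewrite conjsM mulVg conjs1; apply: hurw_refl.
Qed.

(** The full twist of [A] and [C], performed across [B]: pull [A] to [C], let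
    the two blocks jump over each other twice, and bring [A] back. As the
    products commute, each block ends up conjugated by the product of the
    other one only. *)
Lemma hurw_twist A B C :
    commute (prods A) (prods B) -> commute (prods C) (prods B) ->
    commute (prods A) (prods C) ->
  hurw (A ++ B ++ C) (conjs A (prods C) ++ B ++ conjs C (prods A)).
Proof.
move=> cAB cCB cAC; rewrite !catA.
apply: hurw_trans (hurw_catr _ (hurw_mover A B)) _.
apply: hurw_trans (_ : hurw (B ++ conjs A (prods C * prods B) ++
                             conjs C (prods A)) _).
  rewrite -catA; apply: hurw_catl.
  apply: hurw_trans (hurw_mover _ _) _.
  rewrite conjsM cCB; apply: hurw_trans (hurw_mover _ _) _.
  rewrite prods_conjs; suff -> : prods A ^ (prods B * prods C) = prods A.
    exact: hurw_refl.
  apply/conjg_fixP/commgP; exact: commuteM.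
rewrite !catA; apply: hurw_catr.
apply: hurw_sym; apply: hurw_trans (hurw_mover _ _) _.
by rewrite conjsM; apply: hurw_refl.
Qed.

End HurwitzEquivalence.

(** * Monomial elements as permutations of the points *)
Section MonomialModel.
Import GRing.Theory.
Local Open Scope ring_scope.
Variables (n : nat) (A : finZmodType).
Notation X := ('I_n * A)%type.
Implicit Types (u v : 'S_n) (a b : 'I_n -> A) (x y z : 'I_n) (c d : A).
Implicit Types (h s t : {perm X}) (T : seq {perm X}).

Definition wr_fun u a (i : X) : X := (u i.1, i.2 + a i.1).

Lemma wr_inj u a : injective (wr_fun u a).
Proof. by move=> [x c] [y d] [/= /perm_inj <- e]; congr (_, _); exact: addIr e. Qed.

(** The element [u; a] of the wreath product. With permutations of the points
    the group laws are those of a symmetric group, and the conditions on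
    factorizations become statements about points. *)
Definition wr u a : {perm X} := perm (@wr_inj u a).

Definition is_wr (h : {perm X}) := exists u a, h = wr u a.

Lemma wrE u a x c : wr u a (x, c) = (u x, c + a x).
Proof. by rewrite permE. Qed.

Lemma eq_wr u v a b : u = v -> a =1 b -> wr u a = wr v b.
Proof. by move=> -> ab; apply/permP => -[x c]; rewrite !wrE ab. Qed.

Lemma wrM u v a b : (wr u a * wr v b)%g = wr (u * v) (fun x => a x + b (u x)).
Proof. by apply/permP => -[x c]; rewrite permM !wrE permM addrA. Qed.

Lemma wr1 a : a =1 (fun=> 0) -> wr 1 a = 1%g.
Proof. by move=> a0; apply/permP => -[x c]; rewrite wrE !perm1 a0 addr0. Qed.

Lemma wrV u a : (wr u a)^-1%g = wr u^-1 (fun x => - a (u^-1 x)%g).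
Proof.
apply/eqP; rewrite eq_invg_mul wrM mulgV.
by apply/eqP/wr1 => x; rewrite permK subrr.
Qed.

(** For [x != y], this is the reflection that exchanges the fibres above [x] and
    [y] by [(x, d) |-> (y, d + c)]. *)
Definition tr x y c := wr (tperm x y) (fun z => c *+ (z == x) - c *+ (z == y)).
Definition dg x c := wr 1 (fun z => c *+ (z == x)).

Lemma dgM x c d : (dg x c * dg x d)%g = dg x (c + d).
Proof.
by rewrite wrM mulg1; apply: eq_wr => // z; rewrite perm1 mulrnDl.
Qed.

Lemma dg0 x : dg x 0 = 1%g.
Proof. by apply: wr1 => z; rewrite mul0rn. Qed.

Lemma trC x y c : tr x y c = tr y x (- c).
Proof.
by apply: eq_wr => [|z]; rewrite ?(tpermC x) // !mulNrn opprK addrC.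
Qed.

(** This formula, together with [dgJ], is the source of every computation of
    labels below. *)
Lemma trJ x y c u a :
  (tr x y c ^ wr u a)%g = tr (u x) (u y) (c + a y - a x).
Proof.
apply/(mulgI (wr u a)); rewrite conjgE !mulgA mulgV mul1g !wrM.
apply: eq_wr => [|z]; first by rewrite -(tpermJ x y u) conjgE !mulgA mulgV mul1g.
rewrite !(inj_eq perm_inj); have [->|zx] := eqVneq z x.
  rewrite tpermL; have [->|xy] := eqVneq x y; first by rewrite !subrr add0r addr0.
  by rewrite !subr0 mulr1n addrCA subrr addr0.
have [->|zy] := eqVneq z y.
  by rewrite tpermR !mulr1n !mulr0n !sub0r opprB opprD addrCA [a y + _]addrCA subrr addr0 addrC.
by rewrite tpermD 1?eq_sym // !mulr0n !subrr add0r addr0.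
Qed.

Lemma dgJ x c u a : (dg x c ^ wr u a)%g = dg (u x) c.
Proof.
apply/(mulgI (wr u a)); rewrite conjgE !mulgA mulgV mul1g !wrM.
apply: eq_wr => [|z]; first by rewrite mul1g mulg1.
by rewrite perm1 (inj_eq perm_inj) addrC.
Qed.

Lemma trK x y c : (tr x y c * tr x y c)%g = 1%g.
Proof.
rewrite wrM tperm2; apply: wr1 => z.
case: tpermP => [->|->|/eqP/negPf-> /eqP/negPf->].
- have [->|_] := eqVneq x y; first by rewrite !eqxx !subrr addr0.
  by rewrite ?eqxx !mulr1n !mulr0n subr0 add0r subrr.
- have [->|_] := eqVneq y x; first by rewrite !eqxx !subrr addr0.
  by rewrite ?eqxx !mulr1n !mulr0n subr0 add0r addNr.
- by rewrite subrr addr0.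
Qed.

Lemma trV x y c : (tr x y c)^-1%g = tr x y c.
Proof. by apply/eqP; rewrite eq_invg_mul trK. Qed.

Lemma tr_tr x y c d : (tr x y c * tr x y d)%g =
  wr 1 (fun z => (c - d) *+ (z == x) - (c - d) *+ (z == y)).
Proof.
rewrite wrM tperm2; apply: eq_wr => // z.
case: tpermP => [->|->|/eqP/negPf-> /eqP/negPf->].
- have [->|_] := eqVneq x y; first by rewrite !eqxx !subrr addr0.
  by rewrite ?eqxx !mulr1n !mulr0n !subr0 add0r.
- have [->|_] := eqVneq y x; first by rewrite !eqxx !subrr addr0.
  by rewrite ?eqxx !mulr1n !mulr0n subr0 !add0r opprB addrC.
- by rewrite !mulr0n subrr addr0.
Qed.

Lemma tr_tr_tr x y c d e :
  x != y -> (tr x y c * (tr x y d * tr x y e))%g = tr x y (c - (d - e)).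
Proof.
move=> xy; have yx : y != x by rewrite eq_sym.
rewrite tr_tr wrM mulg1; apply: eq_wr => // z.
case: tpermP => [->|->|/eqP/negPf-> /eqP/negPf->].
- by rewrite (negPf xy) (negPf yx) !eqxx !mulr1n !mulr0n !subr0 sub0r.
- by rewrite (negPf xy) (negPf yx) !eqxx !mulr1n !mulr0n !sub0r subr0 opprB addrC.
- by rewrite !mulr0n subrr addr0.
Qed.

Variable P : pred A.
Hypothesis PD : forall c d, P c -> P d -> P (c + d).

Variant is_reflection t : Prop :=
| ReflTr x y c of x != y & t = tr x y c
| ReflDg x c of c != 0 & P c & t = dg x c.

Lemma is_reflectionJ t u a : is_reflection t -> is_reflection (t ^ wr u a)%g.
Proof.
case=> [x y c xy ->|x c c0 Pc ->]; last first.
  by rewrite dgJ; apply: ReflDg c0 Pc _.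
rewrite trJ; apply: (@ReflTr _ (u x) (u y)) => //.
by rewrite (inj_eq perm_inj).
Qed.

Lemma is_reflection_wr t : is_reflection t -> is_wr t.
Proof. by case=> [x y c _ ->|x c _ _ ->]; do 2 eexists. Qed.

Lemma is_reflection_conj s t : is_reflection s -> is_reflection t -> is_reflection (s ^ t)%g.
Proof. by move=> rs /is_reflection_wr[u [a ->]]; apply: is_reflectionJ. Qed.

Lemma is_reflection_conjV s t : is_reflection s -> is_reflection t -> is_reflection (s ^ t^-1)%g.
Proof. by move=> rs /is_reflection_wr[u [a ->]]; rewrite wrV; apply: is_reflectionJ. Qed.

Definition is_factorization T h := (forall t, t \in T -> is_reflection t) /\ prods T = h.

Definition shortest T h :=
  is_factorization T h /\ forall T', is_factorization T' h -> (size T <= size T')%N.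

Lemma is_factorization_cat T1 T2 h1 h2 :
  is_factorization T1 h1 -> is_factorization T2 h2 -> is_factorization (T1 ++ T2) (h1 * h2).
Proof.
move=> [r1 <-] [r2 <-]; split; last by rewrite prods_cat.
by move=> t; rewrite mem_cat => /orP[/r1|/r2].
Qed.

Lemma is_factorization_hurw T T' h : hurw T T' -> is_factorization T h -> is_factorization T' h.
Proof.
move=> TT' [rT <-]; split; last by rewrite (hurw_prods TT').
by apply/(hurw_all is_reflection_conj is_reflection_conjV TT').
Qed.

Lemma shortest_hurw T T' h : hurw T T' -> shortest T h -> shortest T' h.
Proof.
move=> TT' [fT mT]; split; first exact: is_factorization_hurw TT' fT.
by move=> T''; rewrite -(hurw_size TT'); apply: mT.
Qed.

Lemma shortest_sub T1 T T2 h :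
  shortest (T1 ++ T ++ T2) h -> shortest T (prods T).
Proof.
move=> [[rT <-] mT]; split.
  by split=> // t tT; apply: rT; rewrite !mem_cat tT orbT.
move=> T' [rT' eT'].
have /mT : is_factorization (T1 ++ T' ++ T2) (prods (T1 ++ T ++ T2)).
  split; last by rewrite !prods_cat eT'.
  move=> t; rewrite !mem_cat => /or3P[tT|/rT'//|tT].
  - by apply: rT; rewrite mem_cat tT.
  - by apply: rT; rewrite !mem_cat tT !orbT.
by rewrite !size_cat leq_add2l leq_add2r.
Qed.

Lemma shortest_suffix T1 T2 h : shortest (T1 ++ T2) h -> shortest T2 (prods T2).
Proof. by rewrite -{1}[T2]cats0 => /shortest_sub. Qed.

(** A single point of the fibre suffices, since the elements [wr u a] commute
    with the translations of the second coordinate. *)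
Definition fixes x h := h (x, 0) == (x, 0).

Lemma fixes_wr x u a : fixes x (wr u a) = (u x == x) && (a x == 0).
Proof. by rewrite /fixes wrE add0r. Qed.

Lemma fixesJ x s t : fixes x t -> fixes x (s ^ t)%g = fixes x s.
Proof.
by rewrite /fixes => /eqP tx; rewrite -{1}tx permJ -{2}tx (inj_eq perm_inj).
Qed.

Lemma fixesV x t : fixes x t^-1%g = fixes x t.
Proof.
by rewrite /fixes -(inj_eq (@perm_inj _ t)) permKV eq_sym.
Qed.

Lemma fixesM x s t : fixes x s -> fixes x t -> fixes x (s * t)%g.
Proof. by rewrite /fixes permM => /eqP-> /eqP->. Qed.

Lemma fixes_prods x T :
  (forall t, t \in T -> fixes x t) -> fixes x (prods T).
Proof.
elim: T => [|t T IH] fT; first by rewrite prods_nil /fixes perm1.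
rewrite prods_cons; apply: fixesM; first by apply: fT; rewrite mem_head.
by apply: IH => s sT; apply: fT; rewrite inE sT orbT.
Qed.

Lemma hurw_fixes x T T' : hurw T T' ->
  (forall t, t \in T -> fixes x t) -> (forall t, t \in T' -> fixes x t).
Proof.
move=> TT' fT; apply/(hurw_all _ _ TT') => // s t fs ft.
  by rewrite fixesJ.
by rewrite fixesJ // fixesV.
Qed.

Lemma fixes_tr x y z c : x != y -> fixes z (tr x y c) = (z != x) && (z != y).
Proof.
move=> xy; rewrite fixes_wr; case: tpermP => [->|->|/eqP/negPf-> /eqP/negPf->].
- by rewrite eq_sym (negPf xy) eqxx.
- by rewrite (negPf xy) eqxx andbF.
- by rewrite !eqxx subrr eqxx.
Qed.

Lemma fixes_dg x z c : c != 0 -> fixes z (dg x c) = (z != x).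
Proof.
move=> c0; rewrite fixes_wr perm1 eqxx /=.
by have [_|_] := eqVneq z x; rewrite ?(negPf c0) ?eqxx.
Qed.

Lemma moving_reflectionP x t : is_reflection t -> ~~ fixes x t ->
  (exists2 y : 'I_n, x != y & exists c, t = tr x y c) \/
  (exists2 c, c != 0 & P c /\ t = dg x c).
Proof.
case=> [y z c yz ->|y c c0 Pc ->].
  rewrite fixes_tr // negb_and !negbK => /orP[]/eqP->; left.
    by exists z => //; exists c.
  by exists y; rewrite 1?eq_sym //; exists (- c); rewrite trC.
by rewrite fixes_dg // negbK => /eqP->; right; exists c.
Qed.

(** A factor that moves [(x, 0)] may jump to the left over a factor [t] that
    fixes it: conjugation by [t] does not change whether [(x, 0)] is moved. *)
Lemma gather x T : exists T1 T2, [/\ hurw T (T1 ++ T2),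
  all (fun t => ~~ fixes x t) T1, all (fixes x) T2
  & size T1 = count (fun t => ~~ fixes x t) T].
Proof.
elim: T => [|t T [T1 [T2 [TT' tT1 tT2 sT1]]]].
  by exists [::], [::]; split=> //; apply: hurw_refl.
have [ft|nft] := boolP (fixes x t).
  exists (conjs T1 t^-1), (t :: T2); split=> //=; last by rewrite size_map ft.
  - apply: hurw_trans (hurw_catl [:: t] TT') _.
    rewrite -[t :: T2]cat1s !catA; apply: hurw_catr.
    have := hurw_movel [:: t] T1.
    by rewrite prods_cons prods_nil mulg1.
  - rewrite all_map; apply: sub_all tT1 => s /=.
    by rewrite fixesJ // fixesV.
  - by rewrite ft.
exists (t :: T1), T2; split=> //=; rewrite ?nft ?sT1 //.
exact: (hurw_catl [:: t]).
Qed.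

(** If [s] and [t] lead from [x] to different indices then conjugating one by the
    other yields a reflection that no longer involves [x], for instance
    [tr x y _] conjugated by [tr x z _] is some [tr z y _]. Two diagonal
    reflections at [x] have a product that is one diagonal reflection or 1. *)
Lemma pair_reduce x s t :
    is_reflection s -> is_reflection t -> ~~ fixes x s -> ~~ fixes x t ->
  [\/ exists s' t', hurw [:: s; t] [:: s'; t'] /\ (fixes x s' || fixes x t'),
      exists2 T, (size T <= 1)%N & is_factorization T (s * t) |
      exists2 y : 'I_n, x != y & exists c d, s = tr x y c /\ t = tr x y d].
Proof.
move=> rs rt ns nt.
have sw1 : hurw [:: s; t] [:: t; s ^ t]%g := hurw_swap s t [::] [::].
have sw2 : hurw [:: s; t] [:: t ^ s^-1; s]%g.
  by have := hurw_movel [:: s] [:: t]; rewrite prods_cons prods_nil mulg1.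
case: (moving_reflectionP rs ns) => [[y xy [c es]]|[c c0 [Pc es]]];
case: (moving_reflectionP rt nt) => [[z xz [d et]]|[d d0 [Pd et]]].
- have [yz|yz] := eqVneq y z.
    by apply: Or33; exists y => //; exists c, d; rewrite es et yz.
  have zy : z != y by rewrite eq_sym.
  apply: Or31; exists t, (s ^ t)%g; split=> //.
  by rewrite es et trJ tpermL tpermD // [X in _ || X]fixes_tr // xy xz orbT.
- apply: Or31; exists (t ^ s^-1)%g, s; split=> //.
  by rewrite es et trV dgJ tpermL fixes_dg ?xy.
- apply: Or31; exists t, (s ^ t)%g; split=> //.
  by rewrite es et dgJ tpermL fixes_dg ?xz ?orbT.
- apply: Or32; have [cd|cd] := eqVneq (c + d) 0.
    by exists [::] => //; split=> //; rewrite es et dgM cd dg0 prods_nil.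
  exists [:: s * t]%g => //; split; last by rewrite prods_cons prods_nil mulg1.
  move=> r; rewrite inE => /eqP->; rewrite es et dgM.
  by apply: ReflDg cd (PD Pc Pd) _.
Qed.

(** Induction on the number of factors that move [(x, 0)], which [pair_reduce]
    lowers as long as two neighbours are not of the form [tr x y _] with the
    same [y]. Two diagonal reflections at [x] could be merged, and three factors
    [tr x y _] have for product a single one, so neither occurs in a shortest
    factorization. *)
Lemma peel x T h : shortest T h ->
  exists T1 T2, [/\ hurw T (T1 ++ T2), {in T2, forall t, fixes x t} &
   [\/ T1 = [::], exists2 c, c != 0 & P c /\ T1 = [:: dg x c],
       exists2 y : 'I_n, x != y & exists c, T1 = [:: tr x y c] |
       exists2 y : 'I_n, x != y & exists c d, T1 = [:: tr x y c; tr x y d]]].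
Proof.
have [k] := ubnP (count (fun t => ~~ fixes x t) T).
elim: k T => // k IH T; rewrite ltnS => Tk sT.
have [T1 [T2 [TT' tT1 tT2 sT1]]] := gather x T.
have sT' := shortest_hurw TT' sT.
have rT1 t : t \in T1 -> is_reflection t.
  by move=> tT; case: sT' => [[r _] _]; apply: r; rewrite mem_cat tT.
have /allP nT1 := tT1.
have red U s t V s' t' : T1 = U ++ s :: t :: V -> hurw [:: s; t] [:: s'; t'] ->
    fixes x s' || fixes x t' ->
    exists2 T', hurw T T' & (count (fun t => ~~ fixes x t) T' < k)%N.
  move=> eT1 st' f'; exists (U ++ [:: s'; t'] ++ V ++ T2).
    apply: hurw_trans TT' _; rewrite eT1 -catA; apply: hurw_catl.
    by rewrite -[_ ++ T2]/([:: s; t] ++ (V ++ T2)); apply: hurw_catr.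
  have cT2 : count (fun t => ~~ fixes x t) T2 = 0%N.
    apply/eqP; rewrite -leqn0 leqNgt -has_count; apply/hasPn => r rT2.
    by rewrite negbK (allP tT2).
  apply: leq_trans Tk; rewrite -sT1 eT1 !size_cat /= count_cat /= count_cat cT2.
  have := count_size (fun t => ~~ fixes x t) U.
  have := count_size (fun t => ~~ fixes x t) V.
  by case: (fixes x s') (fixes x t') f' => [] [] //= _; lia.
have fin : (exists2 T', hurw T T' &
      (count (fun t => ~~ fixes x t) T' < k)%N) ->
    exists T1 T2, [/\ hurw T (T1 ++ T2), {in T2, forall t, fixes x t} &
   [\/ T1 = [::], exists2 c, c != 0 & P c /\ T1 = [:: dg x c],
       exists2 y : 'I_n, x != y & exists c, T1 = [:: tr x y c] |
       exists2 y : 'I_n, x != y & exists c d, T1 = [:: tr x y c; tr x y d]]].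
  case=> T' TT'' kT'; have [U1 [U2 [UU fU cU]]] := IH _ kT' (shortest_hurw TT'' sT).
  by exists U1, U2; split=> //; apply: hurw_trans TT'' UU.
have short U s t V L : T1 = U ++ s :: t :: V -> (size L <= 1)%N ->
    is_factorization L (s * t) -> False.
  move=> eT1 sL fL; have : shortest (U ++ [:: s; t] ++ (V ++ T2)) h.
    by move: sT'; rewrite eT1 -catA.
  move=> /shortest_sub[_ /(_ L)]; rewrite !prods_cons prods_nil mulg1.
  by move=> /(_ fL) /=; lia.
case: T1 => [|s [|t [|r T1]]] in TT' tT1 sT1 sT' rT1 nT1 red short.
- by exists [::], T2; split=> //; [apply/allP|apply: Or41].
- exists [:: s], T2; split=> //; first exact/allP.
  case: (moving_reflectionP (rT1 _ (mem_head _ _)) (nT1 _ (mem_head _ _))).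
    by move=> [y xy [c ->]]; apply: Or43; exists y => //; exists c.
  by move=> [c c0 [Pc ->]]; apply: Or42; exists c.
- have [] := @pair_reduce x s t;
  try by [apply: rT1; rewrite !inE eqxx ?orbT
         |apply: nT1; rewrite !inE eqxx ?orbT].
  + by move=> [s' [t' [st f']]]; apply: fin; apply: (red [::] s t [::]) st f'.
  + by move=> [L sL fL]; case: (short [::] s t [::] L).
  + move=> [y xy [c [d [es et]]]]; exists [:: s; t], T2.
    split; [exact: TT'|exact/allP|apply: Or44].
    by exists y => //; exists c, d; rewrite es et.
have [] := @pair_reduce x s t;
  try by [apply: rT1; rewrite !inE eqxx ?orbT
         |apply: nT1; rewrite !inE eqxx ?orbT].
+ by move=> [s' [t' [st f']]]; apply: fin; apply: (red [::] s t (r :: T1)) st f'.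
+ by move=> [L sL fL]; case: (short [::] s t (r :: T1) L).
move=> [y xy [c [d [es et]]]].
have [] := @pair_reduce x t r;
  try by [apply: rT1; rewrite !inE eqxx ?orbT
         |apply: nT1; rewrite !inE eqxx ?orbT].
+ by move=> [s' [t' [st f']]]; apply: fin; apply: (red [:: s] t r T1) st f'.
+ by move=> [L sL fL]; case: (short [:: s] t r T1 L).
move=> [z xz [d' [e [et' er]]]].
(* [t] leads from [x] to both [y] and [z]. *)
have ezy : z = y.
  have: (t (x, 0)).1 = (t (x, 0)).1 by [].
  by rewrite {1}et et' !wrE /= !tpermL.
have: shortest ([::] ++ [:: s; t; r] ++ (T1 ++ T2)) h by [].
move=> /shortest_sub[_ /(_ [:: tr x y (c - (d - e))])].
move=> short3; suff /short3 : is_factorization [:: tr x y (c - (d - e))] (prods [:: s; t; r]) by [].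
split; last first.
  by rewrite !prods_cons prods_nil !mulg1 es et er ezy tr_tr_tr.
by move=> q; rewrite inE => /eqP->; apply: ReflTr xy _.
Qed.

End MonomialModel.

(** * Unions of stars *)
Section Stars.
Import GRing.Theory.
Local Open Scope ring_scope.
Variables (n : nat) (A : finZmodType).
Notation X := ('I_n * A)%type.
Implicit Types (u v : 'S_n) (a b w : 'I_n -> A) (x y z : 'I_n) (c d : A).
Implicit Types (h s t : {perm X}) (T : seq {perm X}) (R : 'I_n -> 'I_n).
Implicit Types (l : seq 'I_n).

Definition upd b x c z := if z == x then c else b z.

Definition blockweight w R x := \sum_(z | R z == x) w z.

(** [R] sends each index to the root of its block. A member [x] other than the
    root is tied to it by a pair of factors with product [w x] at [x] and
    [- w x] at the root, and the root absorbs the weight of the whole block. *)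
Definition piece w R b x : seq {perm X} :=
  if R x == x then
    if blockweight w R x == 0 then [::] else [:: dg x (blockweight w R x)]
  else [:: tr (R x) x (b x); tr (R x) x (b x + w x)].

Definition piece_weight w R x z : A :=
  if R x == x then blockweight w R x *+ (z == x)
  else w x *+ (z == x) - w x *+ (z == R x).

Definition stars w R b l := flatten [seq piece w R b x | x <- l].

Lemma wr1M a b : (wr 1 a * wr 1 b)%g = wr 1 (fun z => a z + b z) :> {perm X}.
Proof. by rewrite wrM mulg1; apply: eq_wr => // z; rewrite perm1. Qed.

Lemma commute_wr1 a b : commute (wr 1 a : {perm X}) (wr 1 b).
Proof. by rewrite /commute !wr1M; apply: eq_wr => // z; rewrite addrC. Qed.

Lemma prods_piece w R b x : prods (piece w R b x) = wr 1 (piece_weight w R x).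
Proof.
rewrite /piece /piece_weight; case: eqP => [Rx|/eqP Rx].
  case: eqP => [->|_]; last by rewrite prods_cons prods_nil mulg1.
  by rewrite prods_nil; apply/esym/wr1 => z; rewrite mul0rn.
rewrite !prods_cons prods_nil mulg1 tr_tr opprD addrA subrr add0r.
by apply: eq_wr => // z; rewrite !mulNrn opprK addrC.
Qed.

Lemma stars_cons w R b x l : stars w R b (x :: l) = piece w R b x ++ stars w R b l.
Proof. by []. Qed.

Lemma prods_stars w R b l :
  prods (stars w R b l) = wr 1 (fun z => \sum_(x <- l) piece_weight w R x z).
Proof.
elim: l => [|x l IH].
  by rewrite prods_nil; apply/esym/wr1 => z; rewrite big_nil.
rewrite stars_cons prods_cat prods_piece IH wr1M.
by apply: eq_wr => // z; rewrite big_cons.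
Qed.

(** At a root [z] the block weight counts [w z] once, and the rest of it is
    cancelled by the pairs of the other members of the block. *)
Lemma sum_piece_weight w R z : (forall x, R (R x) = R x) ->
  \sum_x piece_weight w R x z = w z.
Proof.
move=> RR.
have -> : \sum_x piece_weight w R x z = piece_weight w R z z +
    \sum_(x | x != z) piece_weight w R x z by rewrite (bigD1 z).
rewrite {1}/piece_weight eqxx; case: eqP => [Rz|/eqP Rz].
  have -> : blockweight w R z *+ true = w z + \sum_(x | (R x == z) && (x != z)) w x.
    by rewrite mulr1n /blockweight (bigD1 z) //; apply/eqP.
  rewrite -addrA big_mkcondl -big_split /= big1 ?addr0 // => x xz.
  rewrite /piece_weight [z == x]eq_sym (negPf xz) !mulr0n sub0r.
  have [Rx|nRx] := eqVneq (R x) x; first by rewrite Rx (negPf xz) addr0.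
  by rewrite [z == _]eq_sym; case: eqP => _; rewrite ?mulr1n ?mulr0n ?subrr ?subr0.
rewrite eq_sym (negPf Rz) mulr1n mulr0n subr0 big1 ?addr0 // => x xz.
rewrite /piece_weight [z == x]eq_sym (negPf xz) !mulr0n sub0r.
case: eqP => // _; have [zR|] := eqVneq z (R x); last by rewrite oppr0.
by rewrite zR RR eqxx in Rz.
Qed.

Lemma prods_star w R b : (forall x, R (R x) = R x) ->
  prods (stars w R b (enum 'I_n)) = wr 1 w.
Proof.
move=> RR; rewrite prods_stars; apply: eq_wr => // z.
by rewrite big_enum /= sum_piece_weight.
Qed.

Lemma conjs_piece w R b x a :
  conjs (piece w R b x) (wr 1 a) =
  piece w R (upd b x (b x + a x - a (R x))) x.
Proof.
rewrite /piece; case: ifP => [_|Rx].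
  by case: ifP => //= _; rewrite dgJ perm1.
by rewrite /= !trJ !perm1 /upd eqxx -!addrA (addrC (w x)) !addrA.
Qed.

Lemma eq_piece w w' R R' b b' x :
    R x = R' x -> (R x = x -> blockweight w R x = blockweight w' R' x) ->
    (R x != x -> b x = b' x /\ w x = w' x) ->
  piece w R b x = piece w' R' b' x.
Proof.
rewrite /piece => <-; case: (eqVneq (R x) x) => [e /(_ e)-> //|_ _].
by case/(_ isT)=> -> ->.
Qed.

Lemma eq_stars w w' R R' b b' l :
  {in l, forall x, piece w R b x = piece w' R' b' x} ->
  stars w R b l = stars w' R' b' l.
Proof. by move=> e; congr flatten; apply/eq_in_map. Qed.

Lemma stars_upd w R b l x c : x \notin l ->
  stars w R (upd b x c) l = stars w R b l.
Proof.
move=> xl; apply: eq_stars => z zl; apply: eq_piece => // _; split=> //.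
by rewrite /upd; case: eqP zl xl => // -> ->.
Qed.

Lemma stars_cat w R b l l' : stars w R b (l ++ l') = stars w R b l ++ stars w R b l'.
Proof. by rewrite /stars map_cat flatten_cat. Qed.

(** The products of the pieces are diagonal, so that a piece that jumps over
    others stays a piece, and only its label changes. *)
Lemma stars_perm w R b l l' : uniq l -> perm_eq l l' ->
  exists b', hurw (stars w R b l) (stars w R b' l').
Proof.
elim: l' l => [|x l' IH] l ul pl.
  exists b; suff -> : l = [::] by apply: hurw_refl.
  by apply: size0nil; rewrite (perm_size pl).
have xl : x \in l by rewrite (perm_mem pl) mem_head.
case/splitPr: xl ul pl => l1 l2.
rewrite -cat1s uniq_catCA cat1s => /andP[x12 u12].
move=> pl; have pl' : perm_eq (l1 ++ l2) l'.
  by rewrite -(perm_cons x) -(permPr pl) -cat1s perm_catCA.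
have [b' hb'] := IH _ u12 pl'.
pose a z := \sum_(y <- l1) piece_weight w R y z.
pose c := b x + (- a x) - (- a (R x)).
have xl' : x \notin l' by rewrite -(perm_mem pl').
exists (upd b' x c).
rewrite stars_cons stars_upd //.
apply: hurw_trans (_ : hurw (piece w R (upd b x c) x ++ stars w R b (l1 ++ l2)) _); last first.
  rewrite (@eq_piece _ w _ R _ (upd b' x c)) //; last by rewrite /upd eqxx.
  exact: hurw_catl.
rewrite (stars_cat _ _ _ l1 (x :: l2)) stars_cons (stars_cat _ _ _ l1 l2) !catA; apply: hurw_catr.
apply: hurw_trans (hurw_movel (stars w R b l1) (piece w R b x)) _.
rewrite prods_stars wrV invg1 conjs_piece.
rewrite (@eq_piece _ w _ R _ (upd b x c)) //; first exact: hurw_refl.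
by rewrite /upd eqxx !perm1.
Qed.

End Stars.

(** * Reduction of diagonal elements to stars *)
Section DiagonalReduction.
Import GRing.Theory.
Local Open Scope ring_scope.
Variables (n : nat) (A : finZmodType).
Notation X := ('I_n * A)%type.
Implicit Types (u v : 'S_n) (a b w : 'I_n -> A) (x y z : 'I_n) (c d e : A).
Implicit Types (h s t : {perm X}) (T : seq {perm X}) (R : 'I_n -> 'I_n).
Implicit Types (l : seq 'I_n).

Variable P : pred A.
Hypotheses (P0 : P 0) (PD : forall c d, P c -> P d -> P (c + d)).

Lemma sum_delta (Q : pred 'I_n) x c : \sum_(i | Q i) c *+ (i == x) = c *+ Q x.
Proof.
rewrite big_mkcond (bigD1 x) //= eqxx big1 ?addr0 => [|i /negPf->].
  by case: (Q x).
by rewrite mulr0n if_same.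
Qed.

(** Lets a pair that ties [x] to [y] jump over the pair that ties [y] to the
    root [o]: jumping over the first member re-ties [x] to [o], and the second
    member that jumps back over the new pair loses the weight [c - d] of [x],
    which had been merged into the weight of [y]. *)
Lemma pair_exchange x y o (b c d e : A) : x != y -> x != o -> y != o ->
  hurw [:: tr x y c; tr x y d; tr o y b; tr o y (b + (c - d + e))]
       [:: tr o y b; tr o y (b + e); tr o x (b - c); tr o x (b - d)].
Proof.
move=> xy xo yo; have [ox oy] : o != x /\ o != y by rewrite ![o == _]eq_sym.
have yx : y != x by rewrite eq_sym.
have J f : (tr x y f ^ tr o y b)%g = tr o x (b - f).
  rewrite trJ tpermR tpermD // eqxx (negPf yo) (negPf xo) (negPf xy).
  by rewrite mulr1n !mulr0n sub0r !subr0 trC opprB.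
apply: hurw_trans (_ : hurw _
  [:: tr o y b; tr o x (b - c); tr o x (b - d); tr o y (b + (c - d + e))]) _.
  have := hurw_mover [:: tr x y c; tr x y d] [:: tr o y b].
  rewrite prods_cons prods_nil mulg1 /= !J.
  exact: (hurw_catr [:: tr o y (b + (c - d + e))]).
apply: (hurw_catl [:: tr o y b]).
have := hurw_movel [:: tr o x (b - c); tr o x (b - d)]
                   [:: tr o y (b + (c - d + e))].
rewrite !prods_cons prods_nil mulg1 tr_tr wrV invg1 /= trJ !perm1.
rewrite (negPf yo) (negPf yx) eqxx (negPf ox) mulr1n !mulr0n !subr0.
suff -> : b + (c - d + e) - - (b - c - (b - d)) = b + e by [].
have -> : b - c - (b - d) = d - c.
  by rewrite opprB addrC addrA subrK.
by rewrite opprK -(opprB d c) -addrA [_ + e]addrC subrK.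
Qed.

(** Induction on a bound [k] of the support [K], by peeling off the largest
    index [x] of [K]. What remains factors a diagonal element that no longer
    involves [x]; if a pair [tr x y _] was removed then its weight at [y] has
    grown by that of [x], and [x] joins the block of [y]. As the root
    of a block is its least element, [x] can only be the root of [{x}]. *)
Lemma diag_star k w (K : pred 'I_n) T :
    (forall x, K x -> (x < k)%N) -> (forall x, ~~ K x -> w x = 0) ->
    (forall x, ~~ K x -> {in T, forall t, fixes x t}) ->
    shortest P T (wr 1 w) ->
  exists R b,
    [/\ forall x, R (R x) = R x, forall x, (R x <= x)%N,
        forall x, R x != x -> K x && K (R x),
        forall x, P (blockweight w R x)
      & hurw T (stars w R b (enum 'I_n))].
Proof.
elim: k w K T => [|k IH] w K T Kk Kw KT sT.
  have w0 x : w x = 0 by apply: Kw; apply/negP => /Kk.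
  exists id, (fun=> 0); split=> // [x|x|]; first by rewrite eqxx.
    by rewrite /blockweight big1.
  have -> : T = [::].
    have /(_ [::]) := sT.2; rewrite wr1 //; case: (T) => // t T' /= H.
    suff /H : is_factorization P [::] (1 : {perm X})%g by [].
    by split=> //; rewrite prods_nil.
  rewrite /stars; set s := enum _; suff -> : [seq piece w id (fun=> 0) x | x <- s] = [seq [::] | x <- s].
    by elim: (s) => [|x s' IHs] //=; apply: hurw_refl.
  by apply: eq_map => x; rewrite /piece eqxx /blockweight big1 ?eqxx.
have [/existsP[x /andP[/eqP xk Kx]]|/existsPn noK] :=
    boolP [exists x : 'I_n, (x == k :> nat) && K x]; last first.
  apply: (IH w K) => // x Kx; have := Kk _ Kx; have := noK x.
  by rewrite Kx andbT; lia.
pose K' z := K z && (z != x).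
have K'k z : K' z -> (z < k)%N.
  by case/andP=> /Kk; rewrite -val_eqE /= xk; lia.
have [T1 [T2 [TT fT2 cT1]]] := peel PD x sT.
have sT2 : shortest P T2 (prods T2).
  exact: (shortest_suffix (shortest_hurw TT sT)).
have eT : (prods T1 * prods T2)%g = wr 1 w.
  by rewrite -prods_cat -(hurw_prods TT); case: sT => [[_ ->]].
have KT' z : ~~ K z -> {in T1 ++ T2, forall t, fixes z t}.
  by move=> /KT; apply: hurw_fixes.
have K'T z : ~~ K' z -> {in T2, forall t, fixes z t}.
  rewrite negb_and negbK => /orP[/KT' f t tT2|/eqP-> //].
  by apply: f; rewrite mem_cat tT2 orbT.
have fxT2 : fixes x (prods T2) by apply: fixes_prods.
have step w' : prods T2 = wr 1 w' -> (forall z, ~~ K z -> w' z = 0) ->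
    w' x = 0 /\ exists R b,
    [/\ forall x, R (R x) = R x, forall x, (R x <= x)%N,
        forall x, R x != x -> K' x && K' (R x),
        forall x, P (blockweight w' R x)
      & hurw T2 (stars w' R b (enum 'I_n))].
  move=> eT2 Kw'; have w'x : w' x = 0.
    by move: fxT2; rewrite eT2 fixes_wr => /andP[_ /eqP].
  split=> //; apply: (IH w' K') => //; last by rewrite -eT2.
  by move=> z; rewrite negb_and negbK => /orP[/Kw'|/eqP->].
have sK' z : K' z -> K z by case/andP.
case: cT1 => [T10|[c c0 [Pc T1c]]|[y xy [c T1c]]|[y xy [c [d T1c]]]].
- rewrite T10 prods_nil mul1g in eT; rewrite T10 in TT.
  have [_ [R [b [RR Rx RK PR hR]]]] := step w eT Kw.
  exists R, b; split=> // [z Rz|]; last exact: hurw_trans TT hR.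
  by have /andP[/sK'-> /sK'] := RK _ Rz.
- pose w' z := w z - c *+ (z == x).
  have eT2 : prods T2 = wr 1 w'.
    apply: (mulgI (prods T1)); rewrite eT T1c prods_cons prods_nil mulg1.
    by rewrite wr1M; apply: eq_wr => // z; rewrite addrC subrK.
  have [|w'x [R [b [RR Rx RK PR hR]]]] := step w' eT2.
    move=> z Kz; rewrite /w' Kw //; have [ezx|_] := eqVneq z x.
      by rewrite ezx Kx in Kz.
    by rewrite subrr.
  have wx : w x = c by move/eqP: w'x; rewrite /w' eqxx subr_eq0 => /eqP.
  have Rxx : R x = x.
    by apply/eqP/contraT => /RK /andP[]; rewrite /K' eqxx andbF.
  have Rzx z : (R z == x) = (z == x).
    apply/eqP/eqP => [Rz|->//]; apply/eqP/contraT => zx.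
    have /RK/andP[_] : R z != z by rewrite Rz eq_sym.
    by rewrite Rz /K' eqxx andbF.
  have bw z : z != x -> blockweight w R z = blockweight w' R z.
    move=> zx; rewrite /blockweight [RHS]big_split /= sumrN sum_delta.
    by rewrite Rxx eq_sym (negPf zx) subr0.
  have bwx : blockweight w R x = c.
    by rewrite /blockweight (eq_bigl _ _ Rzx) big_pred1_eq.
  have bwx' : blockweight w' R x = 0.
    by rewrite /blockweight (eq_bigl _ _ Rzx) big_pred1_eq.
  have [b1 hb1] : exists b1, hurw (stars w' R b (enum 'I_n))
      (stars w' R b1 (x :: rem x (enum 'I_n))).
    by apply: stars_perm; rewrite ?enum_uniq // perm_to_rem // mem_enum.
  have [b2 hb2] : exists b2, hurw (stars w R b1 (x :: rem x (enum 'I_n)))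
      (stars w R b2 (enum 'I_n)).
    have pe := perm_to_rem (mem_enum 'I_n x).
    apply: stars_perm; last by rewrite perm_sym; apply: pe.
    by rewrite -(perm_uniq pe) enum_uniq.
  exists R, b2; split=> // [z Rz|z|].
  + by have /andP[/sK'-> /sK'] := RK _ Rz.
  + by have [->|zx] := eqVneq z x; rewrite ?bwx // bw.
  apply: hurw_trans TT _; apply: hurw_trans (hurw_catl _ hR) _.
  apply: hurw_trans (hurw_catl _ hb1) _; apply: hurw_trans hb2.
  rewrite !stars_cons T1c [in X in hurw X]/piece Rxx eqxx bwx' eqxx /=.
  rewrite /piece Rxx eqxx bwx (negPf c0) /=.
  apply: (hurw_catl [:: _]); rewrite (@eq_stars _ _ w w' R R b1 b1); first exact: hurw_refl.
  move=> z; rewrite mem_rem_uniq ?enum_uniq // inE => /andP[zx _].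
  by apply: eq_piece => // _; rewrite ?bw // /w' (negPf zx) subr0.
- exfalso; have eT2 : prods T2 = ((prods T1)^-1 * wr 1 w)%g by rewrite -eT mulKg.
  move: fxT2; rewrite eT2 T1c prods_cons prods_nil mulg1 trV wrM fixes_wr mulg1.
  by rewrite tpermL eq_sym (negPf xy).
(* The pair has product [c - d] at [x] and [d - c] at [y], and [x] must keep no
   weight: thus [w x = c - d] goes to [y]. *)
pose w' z := w z - ((c - d) *+ (z == x) - (c - d) *+ (z == y)).
have eT2 : prods T2 = wr 1 w'.
  apply: (mulgI (prods T1)); rewrite eT T1c !prods_cons prods_nil mulg1.
  by rewrite tr_tr wr1M; apply: eq_wr => // z; rewrite addrC subrK.
have Ky : K y.
  apply: contraT => /KT'/(_ (tr x y c)); rewrite T1c mem_head => /(_ isT).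
  by rewrite fixes_tr // eqxx andbF.
have [|w'x [R [b [RR Rx RK PR hR]]]] := step w' eT2.
  move=> z Kz; rewrite /w' Kw //; have [ezx|_] := eqVneq z x.
    by rewrite ezx Kx in Kz.
  have [ezy|_] := eqVneq z y; first by rewrite ezy Ky in Kz.
  by rewrite !mulr0n !subrr.
have yx : y != x by rewrite eq_sym.
have wx : w x = c - d.
  by move/eqP: w'x; rewrite /w' eqxx (negPf xy) subr0 subr_eq0 => /eqP.
have Rxx : R x = x.
  by apply/eqP/contraT => /RK /andP[]; rewrite /K' eqxx andbF.
have Rzx z : (R z == x) = (z == x).
  apply/eqP/eqP => [Rz|->//]; apply/eqP/contraT => zx.
  have /RK/andP[_] : R z != z by rewrite Rz eq_sym.
  by rewrite Rz /K' eqxx andbF.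
pose o := R y; have ox : o != x by rewrite Rzx.
have Ko : K o.
  by rewrite /o; have [->//|/RK/andP[_ /sK']] := eqVneq (R y) y.
pose R1 z := if z == x then o else R z.
have R1x : R1 x = o by rewrite /R1 eqxx.
have R1z z : z != x -> R1 z = R z by rewrite /R1 => /negPf->.
have bw z : z != x -> blockweight w R1 z = blockweight w' R z.
  move=> zx; transitivity (blockweight w' R1 z); last first.
    rewrite /blockweight big_mkcond [RHS]big_mkcond; apply: eq_bigr => i _ /=.
    have [->|/R1z->//] := eqVneq i x.
    by rewrite w'x !if_same.
  rewrite /blockweight [RHS]big_split /= sumrN sumrB !sum_delta.
  by rewrite R1x (R1z _ yx) subrr subr0.
have bwx : blockweight w R1 x = 0.
  rewrite /blockweight big_pred0 // => z; apply/negbTE.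
  by have [->|zx] := eqVneq z x; rewrite ?R1x // R1z // Rzx.
have bwx' : blockweight w' R x = 0.
  by rewrite /blockweight (eq_bigl _ _ Rzx) big_pred1_eq.
have pe := perm_to_rem (mem_enum 'I_n x).
suff [b1 [s [ps hs]]] : exists b1 (s : seq 'I_n), perm_eq s (enum 'I_n) /\
    hurw (T1 ++ T2) (stars w R1 b1 s).
  have [b2 hb2] := stars_perm w R1 b1 (etrans (perm_uniq ps) (enum_uniq _)) ps.
  exists R1, b2; split.
  + move=> z; have [->|zx] := eqVneq z x; first by rewrite R1x R1z // RR.
    by rewrite R1z // R1z ?RR // Rzx.
  + move=> z; have [->|/R1z-> //] := eqVneq z x; rewrite R1x xk.
    apply: leq_trans (Rx y) _; have := Kk _ Ky.
    by rewrite ltnS.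
  + move=> z; have [->|zx] := eqVneq z x; first by rewrite R1x Kx Ko.
    by rewrite R1z // => /RK/andP[/sK'-> /sK'].
  + by move=> z; have [->|zx] := eqVneq z x; rewrite ?bwx // bw.
  + by apply: hurw_trans TT _; apply: hurw_trans hs hb2.
(* If [y] is itself a root then the pair is already in place; otherwise it has to
   be re-tied from [y] to [o]. *)
have [yo|yo] := eqVneq y o.
  have [b1 hb1] : exists b1, hurw (stars w' R b (enum 'I_n))
      (stars w' R b1 (x :: rem x (enum 'I_n))).
    by apply: stars_perm; rewrite ?enum_uniq.
  exists (upd b1 x (- c)), (x :: rem x (enum 'I_n)).
  split; first by rewrite perm_sym.
  apply: hurw_trans (hurw_catl _ hR) _.
  apply: hurw_trans (hurw_catl _ hb1) _.
  have xr : x \notin rem x (enum 'I_n) by rewrite mem_rem_uniq ?enum_uniq // inE eqxx.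
  rewrite !stars_cons stars_upd //.
  rewrite [in X in hurw X]/piece Rxx eqxx bwx' eqxx /=.
  rewrite T1c /piece R1x (negPf ox) /upd eqxx wx -yo.
  rewrite (trC x y c) (trC x y d) addKr.
  apply: (hurw_catl [:: _; _]); rewrite (@eq_stars _ _ w' w R R1 b1 b1); first exact: hurw_refl.
  move=> z; rewrite mem_rem_uniq ?enum_uniq // inE => /andP[zx _].
  apply: eq_piece => //; rewrite ?R1z ?bw // => Rz; split=> //.
  rewrite /w' (negPf zx); have [ezy|_] := eqVneq z y; last by rewrite subrr subr0.
  by rewrite ezy -/o -yo eqxx in Rz.
set l := rem y (rem x (enum 'I_n)).
have pl : perm_eq (enum 'I_n) (y :: x :: l).
  apply: perm_trans pe _; rewrite -[y :: x :: l]/([:: y] ++ [:: x] ++ l) perm_sym perm_catCA /=.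
  rewrite perm_cons perm_sym perm_to_rem // mem_rem_uniq ?enum_uniq // inE yx.
  by rewrite mem_enum.
have [b1 hb1] := stars_perm w' R b (enum_uniq _) pl.
exists (upd b1 x (b1 y - c)), [:: y, x & l]; split; first by rewrite perm_sym.
apply: hurw_trans (hurw_catl _ hR) _.
apply: hurw_trans (hurw_catl _ hb1) _.
have : uniq (y :: x :: l) by rewrite -(perm_uniq pl) enum_uniq.
rewrite /= inE negb_or => /and3P[/andP[_ yl] xl ul].
rewrite !stars_cons stars_upd //.
have oy : o != y by rewrite eq_sym.
rewrite [piece w' R b1 x]/piece Rxx eqxx bwx' eqxx cat0s.
rewrite /piece R1z // -/o (negPf oy) R1x (negPf ox) /upd (negPf yx) eqxx wx T1c.
rewrite (@eq_stars _ _ w' w R R1 b1 b1); last first.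
  move=> z zl; have zx : z != x by apply: contraNneq xl => <-.
  have zy : z != y by apply: contraNneq yl => <-.
  apply: eq_piece => //; rewrite ?R1z ?bw // => Rz; split=> //.
  by rewrite /w' (negPf zx) (negPf zy) !mulr0n !subr0.
rewrite !catA; apply: hurw_catr => /=.
have -> : w' y = c - d + w y by rewrite /w' (negPf yx) eqxx mulr1n mulr0n sub0r opprK addrC.
have -> : b1 y - c + (c - d) = b1 y - d by rewrite addrA subrK.
by apply: pair_exchange => //; rewrite eq_sym.
Qed.

End DiagonalReduction.

(** * Reduction to diagonal elements *)
Section CycleReduction.
Import GRing.Theory.
Local Open Scope ring_scope.
Variables (n : nat) (A : finZmodType).
Notation X := ('I_n * A)%type.
Implicit Types (u v : 'S_n) (a b w : 'I_n -> A) (x y z : 'I_n) (c d e : A).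
Implicit Types (h s t : {perm X}) (T : seq {perm X}) (R : 'I_n -> 'I_n).

Variable P : pred A.
Hypothesis PD : forall c d, P c -> P d -> P (c + d).

Lemma porbit_fix u x z : u x = x -> z \in porbit u x -> z = x.
Proof.
move=> ux /porbitP[i ->]; rewrite permX.
by elim: i => //= i ->.
Qed.

Lemma porbit_step u x : porbit u (u x) = porbit u x.
Proof. by have := porbit_perm u 1 x; rewrite expg1. Qed.

(** Peeling off an index [x] that [u] moves leaves a single factor, which is
    [tr y x (a y)] with [u y = x] because the rest of the product has to fix
    [(x, 0)]. The same element then divides [wr u a] whatever the shortest
    factorization is, and the quotient has the cycles of [u] with [x] made a
    fixed point of weight 0. The function [rho] picks a representative of each
    cycle; the elements of [T0] come from the potential [phi], i.e., they map
    [(x, phi x)] to [(y, phi y)]. *)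
Lemma cycle_reduction u a :
  exists T0 (rho : 'I_n -> 'I_n) (phi : 'I_n -> A),
    [/\ (forall z, rho (u z) = rho z) /\ (forall z, rho z \in porbit u z),
        (forall z, phi (rho z) = 0) /\
        {in T0, forall t, exists x y,
           [/\ x != y, rho x = rho y & t = tr x y (phi y - phi x)]},
        (prods T0 * wr 1 (blockweight a rho))%g = wr u a,
        (size T0 + #|[pred z | rho z == z]| = n)%N
      & forall T, shortest P T (wr u a) -> exists2 T',
          hurw T (T0 ++ T') &
          forall x, rho x != x -> {in T', forall t, fixes x t}].
Proof.
have [k] := ubnP #|[pred x | u x != x]|.
elim: k u a => // k IH u a; rewrite ltnS => uk.
have [/existsP[x ux]|/existsPn u1] := boolP [exists x, u x != x]; last first.
  have eu : u = 1%g.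
    by apply/permP => x; rewrite perm1; apply/eqP; have := u1 x; rewrite negbK.
  exists [::], id, (fun=> 0); split=> //.
  - by split=> z; rewrite ?eu ?perm1 // porbit_id.
  - rewrite prods_nil mul1g eu; apply: eq_wr => // z.
    by rewrite /blockweight big_pred1_eq.
  - by rewrite -[RHS]card_ord; apply: eq_card => z; rewrite !inE eqxx.
  - by move=> T sT; exists T => [|x]; [apply: hurw_refl|rewrite eqxx].
pose y := (u^-1)%g x.
have uy : u y = x by rewrite permKV.
have yx : y != x by apply: contra ux => /eqP yx; rewrite -{1}yx uy.
have xy : x != y by rewrite eq_sym.
pose t := tr y x (a y).
pose v := (tperm y x * u)%g.
pose a1 z := a y *+ (z == y) - a y *+ (z == x) + a (tperm y x z).
have et : (t * wr u a)%g = wr v a1 by rewrite wrM.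
have a1x : a1 x = 0.
  by rewrite /a1 tpermR eqxx (negPf xy) mulr1n mulr0n sub0r addNr.
(* The exponent at [y] has absorbed the exponent at [x]. *)
have a1E z : a z = a1 z + (a x *+ (z == x) - a x *+ (z == y)).
  rewrite /a1; case: tpermP => [->|->|/eqP/negPf-> /eqP/negPf->].
  - by rewrite eqxx (negPf yx) !mulr1n !mulr0n subr0 sub0r addrK.
  - by rewrite eqxx (negPf xy) !mulr1n !mulr0n subr0 sub0r addNr add0r.
  - by rewrite !mulr0n !subr0 addr0 add0r.
have vx : v x = x by rewrite permM tpermR.
have vy : v y = u x by rewrite permM tpermL.
have vz z : z != x -> z != y -> v z = u z.
  by move=> zx zy; rewrite permM tpermD // eq_sym.
have vk : (#|[pred z | v z != z]| < k)%N.
  apply: leq_trans uk; apply: proper_card; apply/properP; split.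
    apply/fintype.subsetP => z; rewrite !inE; apply: contra => /eqP uz.
    have zx : z != x by apply: contraNneq ux => <-; rewrite uz.
    have zy : z != y by apply: contraNneq yx => ezy; rewrite -{1}uy -ezy uz.
    by rewrite vz ?uz.
  by exists x; rewrite !inE ?vx ?eqxx.
have vporb z : porbit u (v z) = porbit u z.
  rewrite permM porbit_step.
  by case: tpermP => // ->; rewrite -{1}uy porbit_step.
have vu z z' : z' \in porbit v z -> z' \in porbit u z.
  case/porbitP=> i ->; suff <- : porbit u ((v ^+ i)%g z) = porbit u z.
    exact: porbit_id.
  by elim: i => [|i IHi]; rewrite ?expg0 ?perm1 // expgSr permM vporb.
have [T0 [rho [phi [[rv rp] [phi0 T0P] pT0 sT0 hT0]]]] := IH v a1 vk.
have rx : rho x = x by apply: porbit_fix (rp x).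
have rhox z : (rho z == x) = (z == x).
  apply/eqP/eqP => [rz|->//]; apply: (porbit_fix vx).
  by rewrite porbit_sym -{1}rz.
pose rho1 z := if z == x then rho y else rho z.
(* The factor [tr y x (a y)] imposes the potential at [x] given that at [y]. *)
pose phi1 z := if z == x then phi y + a y else phi z.
have rho1x : rho1 x = rho y by rewrite /rho1 eqxx.
have rho1z z : z != x -> rho1 z = rho z by rewrite /rho1 => /negPf->.
have phi1z z : z != x -> phi1 z = phi z by rewrite /phi1 => /negPf->.
have rho1nx z : rho1 z != x.
  by have [->|zx] := eqVneq z x; rewrite ?rho1x ?rho1z // rhox.
have rho1k z : rho1 z = rho (if z == x then y else z).
  by rewrite /rho1; case: eqP.
have fix_step T : {in T, forall t, fixes x t} ->
    (forall z, rho z != z -> {in T, forall t, fixes z t}) ->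
    forall z, rho1 z != z -> {in T, forall t, fixes z t}.
  move=> fT fT' z; have [-> _ //|zx] := eqVneq z x.
  by rewrite rho1z //; apply: fT'.
exists (t :: T0), rho1, phi1; split.
- split=> z; last first.
    have [->|zx] := eqVneq z x; last by rewrite rho1z //; apply: vu.
    by rewrite rho1x -{1}uy porbit_step; apply: vu.
  have [->|zy] := eqVneq z y; first by rewrite uy rho1x rho1z.
  have [->|zx] := eqVneq z x; first by rewrite rho1x rho1z // -vy rv.
  have uzx : u z != x by rewrite -uy (inj_eq perm_inj).
  by rewrite !rho1z // -(vz _ zx zy) rv.
- split=> [z|r]; first by rewrite phi1z // rho1k phi0.
  rewrite inE => /predU1P[->|rT0].
    exists y, x; split=> //; first by rewrite rho1x rho1z.
    by rewrite (phi1z y) // /phi1 eqxx addrC addKr.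
  have [p [q [pq rpq ->]]] := T0P _ rT0.
  have px : p != x.
    apply: contraNneq pq => px; rewrite px rx in rpq.
    by rewrite px eq_sym -rhox -rpq.
  have qx : q != x by rewrite -rhox -rpq rhox.
  by exists p, q; split; rewrite ?rho1z ?phi1z.
- rewrite prods_cons -mulgA.
  have -> : wr 1 (blockweight a rho1) = wr 1 (blockweight a1 rho).
    apply: eq_wr => // z; rewrite /blockweight (eq_bigr _ (fun i _ => a1E i)).
    rewrite big_split /= sumrB !sum_delta rho1x rho1z // subrr addr0.
    rewrite big_mkcond [RHS]big_mkcond; apply: eq_bigr => i _ /=.
    have [->|/rho1z->//] := eqVneq i x.
    by rewrite a1x !if_same.
  by rewrite pT0 -et mulgA trK mul1g.
- rewrite -[RHS]sT0 [in RHS](cardD1 x) !inE rx eqxx /= addSn addnS.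
  congr (_ + _).+1; apply: eq_card => z; rewrite !inE.
  have [->|zx] := eqVneq z x; first by rewrite (negPf (rho1nx x)).
  by rewrite rho1z.
move=> T sT; have [T1 [T2 [TT fT2 cT1]]] := peel PD x sT.
have sT2 := shortest_suffix (shortest_hurw TT sT).
have eT : (prods T1 * prods T2)%g = wr u a.
  by rewrite -prods_cat -(hurw_prods TT); case: sT => [[_ ->]].
have eT2 : prods T2 = ((prods T1)^-1 * wr u a)%g by rewrite -eT mulKg.
have fxT2 : fixes x (prods T2) by apply: fixes_prods.
case: cT1 => [T10|[c c0 [Pc T1c]]|[z xz [c T1c]]|[z xz [c [d T1c]]]].
- move: fxT2; rewrite eT2 T10 prods_nil invg1 mul1g fixes_wr.
  by rewrite (negPf ux).
- move: fxT2; rewrite eT2 T1c prods_cons prods_nil mulg1 wrV wrM fixes_wr.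
  by rewrite invg1 permM perm1 (negPf ux).
- move: fxT2; rewrite eT2 T1c prods_cons prods_nil mulg1 trV wrM fixes_wr.
  rewrite permM tpermL -[in X in _ == X]uy (inj_eq perm_inj) => /andP[/eqP ezy].
  rewrite ezy eqxx (negPf xy) mulr1n mulr0n subr0 => /eqP cay.
  have T1t : T1 = [:: t].
    rewrite T1c ezy trC; congr [:: tr _ _ _]; apply/eqP.
    by rewrite -subr_eq0 -opprD oppr_eq0 cay.
  have ePT2 : prods T2 = wr v a1.
    by rewrite eT2 T1t prods_cons prods_nil mulg1 trV.
  rewrite ePT2 in sT2; have [T' TT' fT'] := hT0 _ sT2.
  exists T'; first by apply: hurw_trans TT _; rewrite T1t; apply: (hurw_catl [:: t]).
  apply: fix_step fT' => r rT'; apply: (hurw_fixes TT' fT2).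
  by rewrite mem_cat rT' orbT.
- move: fxT2; rewrite eT2 T1c !prods_cons prods_nil mulg1 tr_tr wrV wrM fixes_wr.
  by rewrite invg1 permM perm1 (negPf ux).
Qed.

End CycleReduction.

(** * Greatest common divisors and lattices *)
Section BigGcd.
Variables (I : eqType) (w : I -> nat) (m : nat).
Implicit Types (s : seq I) (Q : pred I).

Lemma dvdn_big_gcdn s Q d :
  (d %| \big[gcdn/m]_(j <- s | Q j) w j)%N =
  (d %| m)%N && all (fun j => Q j ==> (d %| w j))%N s.
Proof.
elim: s => [|i s IH]; first by rewrite big_nil andbT.
by rewrite big_cons /=; case: (Q i); rewrite /= ?dvdn_gcd IH // andbCA.
Qed.

Lemma big_gcdn_dvd s Q i : i \in s -> Q i ->
  (\big[gcdn/m]_(j <- s | Q j) w j %| w i)%N.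
Proof.
move=> si Qi; have := dvdnn (\big[gcdn/m]_(j <- s | Q j) w j).
by rewrite dvdn_big_gcdn => /andP[_ /allP/(_ i si)]; rewrite Qi.
Qed.

Lemma big_gcdn_dvdm s Q : (\big[gcdn/m]_(j <- s | Q j) w j %| m)%N.
Proof.
have := dvdnn (\big[gcdn/m]_(j <- s | Q j) w j).
by rewrite dvdn_big_gcdn => /andP[].
Qed.

End BigGcd.

Section Lattice.
Import GRing.Theory.
Local Open Scope ring_scope.

(** Bezout coefficients of natural numbers are subtracted, whence the form of
    the hypothesis. *)
Lemma gcdn_closed (S : nat -> Prop) :
    (forall k1 k2 a b c, S k1 -> S k2 -> (a * k1 = b * k2 + c)%N -> S c) ->
  forall k1 k2, S k1 -> S k2 -> S (gcdn k1 k2).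
Proof.
move=> Scl [|k1] k2 S1 S2; first by rewrite gcd0n.
by case: (@egcdnP k1.+1 k2 isT) => a b e _; apply: (Scl _ _ a b _ S1 S2 e).
Qed.

Variables (M : zmodType) (L : M -> Prop).
Hypotheses (L0 : L 0) (LB : forall x y, L x -> L y -> L (x - y)).

Lemma latN x : L x -> L (- x).
Proof. by move=> Lx; rewrite -sub0r; apply: LB. Qed.

Lemma latD x y : L x -> L y -> L (x + y).
Proof. by move=> Lx Ly; rewrite -[y]opprK; apply/LB/latN. Qed.

Lemma latMn x k : L x -> L (x *+ k).
Proof.
by move=> Lx; elim: k => [|k IH]; rewrite ?mulr0n // mulrS; apply: latD.
Qed.

Lemma lat_gcdn x k1 k2 : L (x *+ k1) -> L (x *+ k2) -> L (x *+ gcdn k1 k2).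
Proof.
apply: (gcdn_closed (S := fun k => L (x *+ k))) => {}k1 {}k2 a b c L1 L2 e.
suff -> : x *+ c = x *+ k1 *+ a - x *+ k2 *+ b by apply: LB; apply: latMn.
by rewrite -!mulrnA mulnC e mulrnDr [(k2 * b)%N]mulnC addrC addKr.
Qed.

Variables (I : eqType) (e : I -> M) (w : I -> nat) (m : nat).

(** Add the indices one at a time. Let [q] be the gcd for the indices of [s] and
    [l] the new index. Combining the relations between [l] and the elements of
    [s] with Bezout coefficients gives a vector [v] such that [v *+ q] and
    [e l *+ q + v *+ w l] are in the lattice. With [d = gcd(q, w l)], the second
    one multiplied by [q / d] shows that [e l *+ (q * q / d)] is in the lattice,
    and the gcd of [q * q / d] and [w l] is [d]. *)
Lemma lat_big_gcdn (s : seq I) : (0 < m)%N -> uniq s ->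
    {in s, forall i, L (e i *+ m)} -> {in s, forall i, L (e i *+ w i)} ->
    {in s &, forall i j, i != j -> L (e i *+ w j + e j *+ w i)} ->
  {in s, forall i, L (e i *+ \big[gcdn/m]_(j <- s) w j)}.
Proof.
move=> m0; elim: s => //= l s IH /andP[ls us] Lm Lw Lww.
set q := \big[gcdn/m]_(j <- s) w j.
have sS i : i \in s -> i \in l :: s by rewrite inE => ->; rewrite orbT.
have Lq : {in s, forall i, L (e i *+ q)}.
  apply: IH => // [i /sS/Lm|i /sS/Lw|i j /sS i1 /sS j1] //.
  exact: Lww.
have neq j : j \in s -> l != j by apply: contraTneq => <-.
have [v [vq lv]] : exists v, L (v *+ q) /\ L (e l *+ q + v *+ w l).
  pose S k := exists v, L (v *+ q) /\ L (e l *+ k + v *+ w l).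
  suff : S q by [].
  have eqq : q = \big[gcdn/m]_(j <- s | j \in s) w j by rewrite /q big_seq.
  have Sm : S m.
    exists 0; rewrite !mul0rn addr0; split=> //.
    exact: Lm (mem_head _ _).
  suff : {in s, forall j, S (w j)}.
    move=> Ss; rewrite eqq.
    apply: big_ind => //; apply: gcdn_closed => k1 k2 a b c [v1 [vq1 L1]] [v2 [vq2 L2]] E.
    exists (v1 *+ a - v2 *+ b); split.
      by rewrite mulrnBl !(mulrnAC _ _ q); apply: LB; apply: latMn.
    suff -> : e l *+ c + (v1 *+ a - v2 *+ b) *+ w l =
        (e l *+ k1 + v1 *+ w l) *+ a - (e l *+ k2 + v2 *+ w l) *+ b.
      by apply: LB; apply: latMn.
    rewrite mulrnBl !mulrnDl opprD addrACA !(mulrnAC _ (w l)); congr (_ + _).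
    by rewrite -!mulrnA mulnC E mulrnDr [(k2 * b)%N]mulnC addrC addKr.
  move=> j js; exists (e j); split; first exact: Lq.
  by rewrite addrC; apply: Lww; rewrite ?mem_head ?sS // eq_sym neq.
have q0 : (0 < q)%N.
  rewrite /q; elim: (s) => [|j s' IHs]; first by rewrite big_nil.
  by rewrite big_cons gcdn_gt0 IHs orbT.
have Ld : L (e l *+ gcdn (w l) q).
  set d := gcdn _ _; have d0 : (0 < d)%N by rewrite gcdn_gt0 q0 orbT.
  have [q' eq] : exists q', q = (q' * d)%N by apply/dvdnP/dvdn_gcdr.
  have [w' ew] : exists w', w l = (w' * d)%N by apply/dvdnP/dvdn_gcdl.
  have cq : coprime w' q'.
    rewrite /coprime -(eqn_pmul2r d0) mul1n muln_gcdl -ew -eq.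
    exact: eqxx.
  (* [w l * q'] is a multiple of [q], which annihilates [v]. *)
  have Lqq : L (e l *+ (q' * q)).
    have -> : e l *+ (q' * q) = (e l *+ q + v *+ w l) *+ q' - v *+ q *+ w'.
      rewrite mulrnDl -!mulrnA [(w l * q')%N]mulnC.
      have -> : (q' * w l = q * w')%N by rewrite ew eq mulnAC mulnA.
      by rewrite addrK mulnC.
    by apply: LB; apply: latMn.
  have -> : d = gcdn (w l) (q' * q).
    by rewrite ew [in RHS]eq mulnA -muln_gcdl Gauss_gcdl // (eqP cq) mul1n.
  by apply: lat_gcdn => //; apply: Lw; apply: mem_head.
move=> i; rewrite inE => /predU1P[->|si]; rewrite big_cons -/q //.
apply: lat_gcdn; last exact: Lq.
have : L (e l *+ w i + e i *+ w l).
  by apply: Lww; rewrite ?mem_head ?sS ?neq.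
have : L (e l *+ w i).
  have /dvdnP[k ->] : (gcdn (w l) q %| w i)%N.
    apply: dvdn_trans (dvdn_gcdr _ _) _; rewrite /q.
    exact: big_gcdn_dvd.
  by rewrite mulnC mulrnA; apply: latMn.
by move=> L1 L2; rewrite -[e i *+ _](addKr (e l *+ w i)) addrC; apply: LB.
Qed.

End Lattice.

(** * Moves that change the labels of a star *)
Section StarShifts.
Import GRing.Theory.
Local Open Scope ring_scope.
Variables (n : nat) (A : finZmodType) (w : 'I_n -> A) (R : 'I_n -> 'I_n).
Hypothesis RR : forall x, R (R x) = R x.
Implicit Types (b : 'I_n -> A) (x y z : 'I_n) (c d : A).
Implicit Types (v : {ffun 'I_n -> A}) (l : seq 'I_n).

Definition star b := stars w R b (enum 'I_n).

(** The vectors [v] such that adding [v] to any labels stays in the Hurwitz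
    orbit; they form a lattice by [shift0] and [shiftB]. *)
Definition shift v := forall b, hurw (star b) (star (fun z => b z + v z)).

Definition delta x c : {ffun 'I_n -> A} := [ffun z => c *+ (z == x)].

Lemma deltaMn x c k : delta x c *+ k = delta x (c *+ k).
Proof. by apply/ffunP => z; rewrite ffunMnE !ffunE mulrnAC. Qed.

Lemma eq_stars_nonroot b b' l : (forall x, R x != x -> b x = b' x) ->
  stars w R b l = stars w R b' l.
Proof. by move=> e; apply: eq_stars => x _; apply: eq_piece => // /e. Qed.

Lemma shift0 : shift 0.
Proof.
move=> b; rewrite /star (@eq_stars_nonroot _ b); first exact: hurw_refl.
by move=> x _; rewrite ffunE addr0.
Qed.

Lemma shiftB v v' : shift v -> shift v' -> shift (v - v').
Proof.
move=> sv sv' b; apply: hurw_trans (sv b) _.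
apply: hurw_trans (hurw_sym (sv' (fun z => b z + (v - v') z))).
rewrite /star (@eq_stars_nonroot _ (fun z => b z + v z)); first exact: hurw_refl.
by move=> x _; rewrite !ffunE -addrA subrK.
Qed.

(** The move that replaces [s, t] by [t, s ^ t] turns the pair with labels [c]
    and [c + w x] into the pair with labels [c + w x] and [c + w x + w x]. *)
Lemma shift_self x : R x != x -> shift (delta x (w x)).
Proof.
move=> Rx b; rewrite /star; have := mem_enum 'I_n x; rewrite inE.
have := enum_uniq 'I_n; move: (enum 'I_n) => l ul xl.
case/splitPr: xl ul => l1 l2; rewrite -cat1s uniq_catCA => /andP[x12 _].
have same l' : x \notin l' ->
    stars w R (fun z => b z + delta x (w x) z) l' = stars w R b l'.
  move=> xl'; apply: eq_stars => z zl; apply: eq_piece => // _.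
  rewrite ffunE; have [ez|_] := eqVneq z x; last by rewrite mulr0n addr0.
  by rewrite -ez zl in xl'.
move: x12; rewrite mem_cat negb_or => /andP[x1 x2].
rewrite !stars_cat (same _ x1) (same _ x2).
apply: hurw_catl; apply: hurw_catr.
rewrite /stars /= /piece (negPf Rx) ffunE eqxx /= mulr1n.
have := hurw_swap (tr (R x) x (b x)) (tr (R x) x (b x + w x)) [::] [::].
rewrite trJ tpermL tpermR !eqxx (negPf Rx) [x == R x]eq_sym (negPf Rx).
rewrite mulr1n mulr0n sub0r subr0 [tr x _ _]trC /=.
suff -> : - (b x - (b x + w x) - (b x + w x)) = b x + w x + w x by [].
by rewrite !opprB; congr (_ + _); rewrite addrAC subrr add0r.
Qed.

(** The full twist of the pieces of [x] and [y]. When [y] is the root of [x], the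
    second term vanishes and the first one is minus the weight of the block. *)
Lemma shift_twist x y : x != y ->
  shift (delta x (piece_weight w R y x - piece_weight w R y (R x)) +
         delta y (piece_weight w R x y - piece_weight w R x (R y))).
Proof.
move: x y.
have split_twist x y l1 l2 l3 : enum 'I_n = l1 ++ x :: l2 ++ y :: l3 ->
  shift (delta x (piece_weight w R y x - piece_weight w R y (R x)) +
         delta y (piece_weight w R x y - piece_weight w R x (R y))).
  move=> el b; rewrite /star; have := enum_uniq 'I_n; rewrite el.
  rewrite cat_uniq /= has_cat /= !negb_or cat_uniq mem_cat inE !negb_or /=.
  case/and5P=> _ /and4P[x1 _ y1 _] /and3P[x2 xy x3] _.
  case/and3P=> /andP[y2 _] y3 _.
  set v := _ + _; have vE z : z != x -> z != y -> v z = 0.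
    by move=> /negPf zx /negPf zy; rewrite !ffunE zx zy addr0.
  have same l : x \notin l -> y \notin l ->
      stars w R (fun z => b z + v z) l = stars w R b l.
    move=> xl yl; apply: eq_stars => z zl; apply: eq_piece => // _.
    by rewrite vE ?addr0 //; apply: contraTneq zl => ->.
  rewrite !(stars_cat, stars_cons) !same //.
  apply: hurw_catl.
  have yx : y != x by rewrite eq_sym.
  have -> : piece w R (fun z => b z + v z) x =
      conjs (piece w R b x) (prods (piece w R b y)).
    rewrite prods_piece conjs_piece; apply: eq_piece => // _; split=> //.
    by rewrite /upd eqxx !ffunE eqxx (negPf xy) mulr0n mulr1n addr0 addrA.
  have -> : piece w R (fun z => b z + v z) y =
      conjs (piece w R b y) (prods (piece w R b x)).
    rewrite prods_piece conjs_piece; apply: eq_piece => // _; split=> //.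
    by rewrite /upd eqxx !ffunE eqxx (negPf yx) mulr0n mulr1n add0r addrA.
  rewrite !catA; apply: hurw_catr; rewrite -!catA.
  by apply: hurw_twist; rewrite ?prods_piece ?prods_stars; apply: commute_wr1.
move=> x y xy.
have := mem_enum 'I_n y; have := mem_enum 'I_n x; rewrite !inE.
move=> xl; move: (xl); case/splitPr def_l : {1}(enum 'I_n) / (xl) => [l1 l3] _.
rewrite {1}def_l mem_cat inE eq_sym (negPf xy) /= => /orP[yl|yl].
  case/splitPr def_l1 : {1}l1 / yl => [p q].
  by rewrite addrC; apply: (split_twist y x p q l3); rewrite def_l def_l1 -catA.
case/splitPr def_l3 : {1}l3 / yl => [p q].
by apply: (split_twist x y l1 p q); rewrite def_l def_l3.
Qed.

Variables (g0 : A) (wn : 'I_n -> nat) (m : nat).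
Hypotheses (m_gt0 : (0 < m)%N) (g0m : g0 *+ m = 0).
Hypothesis wE : forall x, w x = g0 *+ wn x.

Definition block_gcd o := \big[gcdn/m]_(z | R z == o) wn z.

(** The twists between the members other than the root give the gcd of m and
    their weights; the twist with the root adds the weight of the block, hence
    that of the root. *)
Lemma shift_gcd x : R x != x -> shift (delta x (g0 *+ block_gcd (R x))).
Proof.
move=> Rx; set o := R x.
have Ro : R o = o by rewrite RR.
pose s := [seq z <- enum 'I_n | (R z == o) && (z != o)].
have sP z : (z \in s) = (R z == o) && (z != o) by rewrite mem_filter mem_enum andbT.
have sR z : z \in s -> R z = o /\ R z != z.
  by rewrite sP => /andP[/eqP-> zo]; rewrite eq_sym.
pose e z := delta z g0.
have Lm : {in s, forall z, shift (e z *+ m)}.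
  move=> z _; rewrite deltaMn g0m; suff -> : delta z 0 = 0 by apply: shift0.
  by apply/ffunP => i; rewrite !ffunE mul0rn.
have Lw : {in s, forall z, shift (e z *+ wn z)}.
  by move=> z /sR[_ Rz]; rewrite deltaMn -wE; apply: shift_self.
have Lww : {in s &, forall z z', z != z' -> shift (e z *+ wn z' + e z' *+ wn z)}.
  move=> z z' /sR[zo zz] /sR[zo' zz'] nzz; rewrite !deltaMn -!wE.
  have := shift_twist nzz; rewrite /piece_weight !(negPf zz, negPf zz') zo zo'.
  have nz'z : z' != z by rewrite eq_sym.
  rewrite zo in zz; rewrite zo' in zz'.
  rewrite (negPf nzz) (negPf nz'z) !eqxx (negPf zz) (negPf zz').
  rewrite ![_ == o]eq_sym (negPf zz) (negPf zz').
  by rewrite !mulr1n !mulr0n !sub0r !oppr0 !opprK !add0r.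
have xs : x \in s by rewrite sP eqxx eq_sym.
have ox : o != x by [].
have Lq := lat_big_gcdn shift0 shiftB m_gt0 (filter_uniq _ (enum_uniq _)) Lm Lw Lww xs.
pose W := \sum_(z | R z == o) wn z.
have LW : shift (e x *+ W).
  have eW : g0 *+ W = blockweight w R o.
    rewrite -sumrMnr; apply: eq_bigr => z _; exact/esym/wE.
  have xo : x != o by rewrite eq_sym.
  have pox : piece_weight w R o x = 0 by rewrite /piece_weight Ro eqxx (negPf xo).
  have poo : piece_weight w R o o = blockweight w R o.
    by rewrite /piece_weight Ro eqxx.
  have := shift_twist xo; rewrite pox Ro -/o poo subrr sub0r deltaMn eW => H.
  suff -> : delta x (blockweight w R o) = 0 - (delta x (- blockweight w R o) + delta o 0).
    by apply: shiftB => //; apply: shift0.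
  by apply/ffunP => z; rewrite !ffunE mul0rn addr0 sub0r mulNrn opprK.
have := lat_gcdn shift0 shiftB Lq LW; rewrite deltaMn.
set D := gcdn _ _ => LD.
have /dvdnP[k ->] : (D %| block_gcd o)%N.
  rewrite dvdn_big_gcdn; apply/andP; split.
    by apply: dvdn_trans (dvdn_gcdl _ _) (big_gcdn_dvdm _ _ _ _).
  have Ds z : z \in s -> (D %| wn z)%N.
    by move=> zs; apply: dvdn_trans (dvdn_gcdl _ _) (big_gcdn_dvd _ _ _ _).
  apply/allP => z _; apply/implyP => zo; have [->|nzo] := eqVneq z o; last first.
    by apply: Ds; rewrite sP zo.
  have : (D %| W)%N := dvdn_gcdr _ _.
  rewrite /W (bigD1 o) /=; last exact/eqP.
  rewrite dvdn_addl //; apply: dvdn_sum => i /andP[io nio].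
  by apply: Ds; rewrite sP io.
by rewrite mulnC mulrnA -deltaMn; exact (latMn shift0 shiftB _ LD).
Qed.

Lemma star_congr b b' :
    (forall x, R x != x -> exists k, b' x = b x + g0 *+ (block_gcd (R x) * k)) ->
  hurw (star b) (star b').
Proof.
move=> bb'; have /fin_all_exists[k kE] : forall x, exists k,
    R x != x -> b' x = b x + g0 *+ (block_gcd (R x) * k).
  move=> x; have [|] := boolP (R x != x); last by exists 0%N.
  by move=> /bb'[k ->]; exists k.
pose v := \sum_(x | R x != x) delta x (g0 *+ (block_gcd (R x) * k x)).
have sv : shift v.
  apply: big_ind => [|? ?|x Rx]; first exact: shift0.
    exact: (latD shift0 shiftB).
  rewrite mulrnA -deltaMn; exact (latMn shift0 shiftB _ (shift_gcd Rx)).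
apply: hurw_trans (sv b) _; rewrite /star (@eq_stars_nonroot _ b'); first exact: hurw_refl.
move=> x Rx; rewrite kE //; congr (_ + _); rewrite sum_ffunE (bigD1 x) //=.
rewrite ffunE eqxx mulr1n big1 ?addr0 // => z /andP[_ zx].
by rewrite ffunE eq_sym (negPf zx) mulr0n.
Qed.

End StarShifts.

(** * Invariants of the normal forms *)
Section StarFactorizations.
Import GRing.Theory.
Local Open Scope ring_scope.
Variables (n : nat) (A : finZmodType) (P : pred A).
Variables (w : 'I_n -> A) (R : 'I_n -> 'I_n).
Implicit Types (b : 'I_n -> A) (x y z : 'I_n) (c d : A).

Lemma star_fact b : (forall x, R (R x) = R x) ->
  (forall x, P (blockweight w R x)) -> is_factorization P (star w R b) (wr 1 w).
Proof.
move=> RR PR; split; last exact: prods_star.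
move=> t /flattenP[_ /mapP[x _ ->]]; rewrite /piece.
case: ifP => [_|/negbT Rx].
  case: ifP => // /negbT bx; rewrite inE => /eqP->.
  exact: ReflDg bx (PR x) _.
by rewrite !inE => /orP[]/eqP->; apply: ReflTr Rx _.
Qed.

(** Two factors for each index that is not a root, one for each root whose block
    has nonzero weight. *)
Lemma star_size b :
  (size (star w R b) + (#|[pred x | R x == x]| +
     #|[pred x | (R x == x) && (blockweight w R x == 0%R)]|) = n.*2)%N.
Proof.
rewrite size_flatten /shape -map_comp sumnE big_map big_enum /=.
rewrite -!sum1_card [X in (_ + (X + _))%N]big_mkcond [X in (_ + (_ + X))%N]big_mkcond.
rewrite -!big_split /= -[in RHS](card_ord n) -muln2 -sum_nat_const.
apply: eq_bigr => x _; rewrite /piece !inE.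
by case: (R x == x) => //; case: (blockweight w R x == 0).
Qed.

End StarFactorizations.

Section Potential.
Import GRing.Theory.
Local Open Scope ring_scope.

Lemma telescope_add (V : zmodType) (c d x y : V) :
  d + c - y = d - x + (c - (y - x)).
Proof. by rewrite opprB [c + (_ - _)]addrCA [RHS]addrA subrK addrA. Qed.

Lemma telescope_sub (V : zmodType) (c d x y : V) :
  d - c - x + (c - (y - x)) = d - y.
Proof. by rewrite -telescope_add subrK. Qed.

Lemma telescope_common (V : zmodType) (x y z : V) : y + z - (x + z) = y - x.
Proof. by rewrite opprD addrACA subrr addr0. Qed.

Variables (n m' : nat).
Notation A := 'I_m'.+1.
Notation m := m'.+1.
Notation X := ('I_n * A)%type.
Implicit Types (b : 'I_n -> A) (x y z : 'I_n) (c d k : A) (t : {perm X}).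

Lemma val_addr_mod r d k : (r %| m)%N -> (r %| k)%N ->
  ((d + k)%R %% r = d %% r)%N.
Proof.
move=> rm /dvdnP[q ek]; rewrite /= modn_dvdm //.
by rewrite [nat_of_ord k]ek addnC modnMDl.
Qed.

Variables (rho : 'I_n -> 'I_n) (phi : 'I_n -> A) (T0 : seq {perm X}).
Variable w : 'I_n -> A.
Hypothesis phi0 : forall z, phi (rho z) = 0.
Hypothesis T0P : {in T0, forall t, exists x y,
  [/\ x != y, rho x = rho y & t = tr x y (phi y - phi x)]}.
Hypothesis w_rho : forall z, rho z != z -> w z = 0.

(** The smallest member of a block is its root, which makes [R] a canonical
    encoding of a partition of the representatives of the cycles. *)
Definition rooting (R : 'I_n -> 'I_n) :=
  [/\ forall x, R (R x) = R x, forall x, (R x <= x)%N &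
      forall x, R x != x -> rho x = x /\ rho (R x) = R x].

Section OnePotential.
Variables (R : 'I_n -> 'I_n) (b : 'I_n -> A).
Hypothesis rR : rooting R.

Let r := block_gcd R (fun z => nat_of_ord (w z)) m.
Let f z : A := phi z + (if R (rho z) == rho z then 0 else b (rho z)).

(** The labels of a normal form are, modulo the gcd [r] of the block, the
    differences of the potential [f]; this function is constant on the orbits of
    the subgroup of the elements that respect [R] and [f]. *)
Definition potential_class (i : X) : 'I_n * nat :=
  (R (rho i.1), ((i.2 - f i.1)%R %% r (R (rho i.1)))%N).

Lemma potential_classE x c :
  potential_class (x, c) = (R (rho x), ((c - f x)%R %% r (R (rho x)))%N).
Proof. by []. Qed.

Let dvd_m o : (r o %| m)%N.
Proof. exact: big_gcdn_dvdm. Qed.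

Lemma tr_potential x y c : R (rho x) = R (rho y) ->
    (r (R (rho x)) %| (c - (f y - f x))%R)%N ->
  forall i, potential_class (tr x y c i) = potential_class i.
Proof.
move=> Rxy rc [z d]; rewrite wrE !potential_classE.
case: tpermP => [->|->|/eqP/negPf-> /eqP/negPf->]; last first.
- by rewrite subr0 addr0.
- rewrite -Rxy; congr (_, _); have [xy|xy] := eqVneq y x.
    by rewrite xy eqxx subrr addr0.
  rewrite eqxx mulr0n mulr1n sub0r -(val_addr_mod _ (dvd_m _) rc).
  congr (nat_of_ord _ %% _)%N.
  exact: telescope_sub.
rewrite -Rxy; congr (_, _); have [xy|xy] := eqVneq x y.
  by rewrite -xy eqxx subrr addr0.
rewrite eqxx mulr0n mulr1n subr0 -[RHS](val_addr_mod _ (dvd_m _) rc).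
congr (nat_of_ord _ %% _)%N.
exact: telescope_add.
Qed.

Lemma dg_potential x c : (r (R (rho x)) %| c)%N ->
  forall i, potential_class (dg x c i) = potential_class i.
Proof.
move=> rc [z d]; rewrite wrE !potential_classE perm1.
have [->|_] := eqVneq z x; last by rewrite mulr0n addr0.
rewrite mulr1n; congr (_, _).
rewrite -[RHS](val_addr_mod _ (dvd_m _) rc); congr (nat_of_ord _ %% _)%N.
exact: addrAC.
Qed.

Lemma normal_potential t : t \in T0 ++ star w R b ->
  forall i, potential_class (t i) = potential_class i.
Proof.
have [RR _ Rrho] := rR.
rewrite mem_cat => /orP[/T0P[x [y [_ rxy ->]]]|].
  apply: tr_potential; rewrite ?rxy //.
  have -> : f y - f x = phi y - phi x.
    by rewrite /f rxy; apply: telescope_common.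
  by rewrite subrr; apply: dvdn0.
case/flattenP=> _ /mapP[x _ ->]; rewrite /piece.
have rw z : (r (R z) %| w z)%N.
  by apply: (@big_gcdn_dvd _ (fun i => nat_of_ord (w i))); rewrite ?mem_index_enum.
case: ifP => [/eqP Rx|/negbT Rx].
  case: ifP => // _; rewrite inE => /eqP->; apply: dg_potential.
  have [rx|rx] := eqVneq (rho x) x.
    rewrite rx Rx /blockweight; apply: (big_ind (fun c : A => r x %| c)%N) => //.
    - by move=> c d rc rd; rewrite /dvdn val_addr_mod.
    - by move=> z /eqP <-.
  have -> : blockweight w R x = 0; last exact: dvdn0.
  rewrite /blockweight big1 // => z /eqP Rz; apply: w_rho.
  have [ezx|ezx] := eqVneq z x; first by rewrite ezx.
  have /Rrho[_] : R z != z by rewrite Rz eq_sym.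
  by rewrite Rz => /eqP; rewrite (negPf rx).
have [rx rRx] := Rrho x Rx.
have px : phi x = 0 by rewrite -rx phi0.
have pRx : phi (R x) = 0 by rewrite -rRx phi0.
have fx : f x - f (R x) = b x.
  by rewrite /f rx rRx RR eqxx (negPf Rx) px pRx add0r addr0 subr0.
rewrite !inE => /orP[]/eqP->; apply: tr_potential; rewrite ?rRx ?rx ?RR // fx.
  by rewrite subrr; apply: dvdn0.
by rewrite addrC addKr.
Qed.

End OnePotential.

(** The pair that ties [x] to [R' x] maps a point above [R' x] to one above [x],
    which have to lie in the same block of [R]. *)
Lemma potential_roots R b R' b' : rooting R -> rooting R' ->
    (forall t, t \in T0 ++ star w R' b' ->
       forall i, potential_class R b (t i) = potential_class R b i) ->
  forall x, R (R' x) = R x.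
Proof.
move=> [RR _ Rrho] [RR' _ Rrho'] H x.
have [->//|R'x] := eqVneq (R' x) x.
have [rx rR'x] := Rrho' x R'x.
have := H (tr (R' x) x (b' x)) _ (R' x, 0).
rewrite wrE tpermL /potential_class /= rx rR'x => /(_ _)/(congr1 fst) /= -> //.
rewrite mem_cat; apply/orP; right; apply/flattenP.
exists (piece w R' b' x); first by apply: map_f; rewrite mem_enum.
by rewrite /piece (negPf R'x) mem_head.
Qed.

(** By [potential_roots] each of the two partitions refines the other one, and
    the roots are least elements of the blocks. The labels are then read off on
    the pair that ties [x] to its root, where the potential is 0. *)
Lemma star_inj R b R' b' : rooting R -> rooting R' ->
    hurw (T0 ++ star w R b) (T0 ++ star w R' b') ->
  R =1 R' /\ forall x, R x != x ->
    b x = b' x %[mod block_gcd R (fun z => nat_of_ord (w z)) m (R x)].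
Proof.
move=> rR rR' hh.
have pres R1 b1 R2 b2 : rooting R1 ->
    hurw (T0 ++ star w R1 b1) (T0 ++ star w R2 b2) ->
    forall t, t \in T0 ++ star w R2 b2 ->
       forall i, potential_class R1 b1 (t i) = potential_class R1 b1 i.
  move=> r1 h12.
  pose Q (t : {perm X}) :=
    forall i, potential_class R1 b1 (t i) = potential_class R1 b1 i.
  have QJ s t : Q s -> Q t -> Q (s ^ t)%g.
    by move=> Hs Ht j; rewrite -{1}[j](permKV t) permJ Ht Hs -[LHS]Ht permKV.
  have QV t : Q t -> Q t^-1%g.
    by move=> Ht i; rewrite -[LHS]Ht permKV.
  apply/(hurw_all (Q := Q) _ _ h12) => // [s t Hs /QV|t tT].
    exact: QJ.
  exact: normal_potential tT.
have H := pres _ _ _ _ rR hh.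
have H' := pres _ _ _ _ rR' (hurw_sym hh).
have RR'E := potential_roots rR rR' H.
have R'RE := potential_roots rR' rR H'.
have eR : R =1 R'.
  move=> x; apply/val_inj/eqP; rewrite eqn_leq.
  case: rR rR' => [_ lR _] [_ lR' _].
  by rewrite -{1}(RR'E x) lR -{1}(R'RE x) lR'.
split=> // x Rx; have [RR _ Rrho] := rR; have [rx rRx] := Rrho x Rx.
have := H (tr (R x) x (b' x)) _ (R x, 0).
have px : phi x = 0 by rewrite -rx phi0.
have pRx : phi (R x) = 0 by rewrite -rRx phi0.
rewrite wrE tpermL !potential_classE rx rRx RR !eqxx (negPf Rx) px pRx.
rewrite mulr0n mulr1n !addr0 !add0r !subr0 => HH.
have /HH/(congr1 snd) : tr (R x) x (b' x) \in T0 ++ star w R' b'.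
  rewrite mem_cat; apply/orP; right; apply/flattenP.
  exists (piece w R' b' x); first by apply: map_f; rewrite mem_enum.
  by rewrite /piece -eR (negPf Rx) mem_head.
rewrite oppr0; set r := block_gcd _ _ _ _; rewrite [LHS]/snd [RHS]/snd mod0n => e.
have rm : (r %| m)%N by apply: big_gcdn_dvdm.
have rd : (r %| (b' x - b x)%R)%N by apply/eqP.
rewrite -(val_addr_mod (b x) rm rd); congr (nat_of_ord _ %% _)%N.
by rewrite addrC subrK.
Qed.

End Potential.

(** * Partitions of the cycles and their roots *)
Section RootedPartitions.
Import boot.finset.
Variables (n : nat) (C : finType) (cyc : 'I_n -> C) (rho : 'I_n -> 'I_n).
Hypothesis cycE : forall x y, cyc x = cyc y <-> rho x = rho y.
Hypothesis rhoK : forall x, rho (rho x) = rho x.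
Implicit Types (x y o k : 'I_n) (Pi : {set {set C}}) (R : 'I_n -> 'I_n).

Definition reps := [set x | rho x == x].

Lemma cyc_inj : {in reps &, injective cyc}.
Proof. by move=> x y; rewrite !inE => /eqP rx /eqP ry /cycE; rewrite rx ry. Qed.

Lemma mem_cyc_reps c : c \in codom cyc -> exists2 x, x \in reps & c = cyc x.
Proof.
case/codomP=> x ->; exists (rho x); first by rewrite inE rhoK.
by apply/cycE; rewrite rhoK.
Qed.

Definition root_of Pi x :=
  if rho x == x then
    [arg min_(k < x | (k \in reps) && (cyc k \in pblock Pi (cyc x))) k]
  else x.

Definition roots R := [set o in reps | R o == o].
Definition block R o := cyc @: [set x in reps | R x == o].
Definition blocks R := block R @: roots R.

Section FromPartition.
Variable Pi : {set {set C}}.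
Hypothesis PiP : partition Pi (cyc @: setT).

Let tPi : trivIset Pi. Proof. by case/and3P: PiP. Qed.
Let cPi : cover Pi = cyc @: setT. Proof. by case/and3P: PiP => /eqP. Qed.

Lemma cyc_cover x : cyc x \in cover Pi.
Proof. by rewrite cPi imset_f. Qed.

Lemma root_ofP x : x \in reps ->
  [/\ root_of Pi x \in reps, cyc (root_of Pi x) \in pblock Pi (cyc x)
    & forall k, k \in reps -> cyc k \in pblock Pi (cyc x) -> root_of Pi x <= k].
Proof.
move=> Kx; have := Kx; rewrite inE /root_of => ->.
case: arg_minnP; first by rewrite Kx mem_pblock cyc_cover.
by move=> k /andP[Kk bk] mk; split=> // j Kj bj; apply: mk; rewrite Kj.
Qed.

Lemma root_of_nrep x : x \notin reps -> root_of Pi x = x.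
Proof. by rewrite inE /root_of => /negPf->. Qed.

Lemma root_of_eq x y : x \in reps -> y \in reps ->
  (root_of Pi x == root_of Pi y) = (cyc y \in pblock Pi (cyc x)).
Proof.
move=> Kx Ky; have [Kr br mr] := root_ofP Kx; have [Kr' br' mr'] := root_ofP Ky.
apply/eqP/idP => [e|b].
  rewrite -(same_pblock tPi br) e (same_pblock tPi br') mem_pblock.
  exact: cyc_cover.
have e := same_pblock tPi b; apply/val_inj/eqP; rewrite eqn_leq /=.
by rewrite mr ?e // -?e // mr' // e.
Qed.

Lemma root_of_rooting : rooting rho (root_of Pi).
Proof.
split=> x; have [Kx|Kx] := boolP (x \in reps); rewrite ?(root_of_nrep Kx) //.
- have [Kr br _] := root_ofP Kx; apply/esym/eqP.
  by rewrite root_of_eq.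
- have [_ _] := root_ofP Kx; apply=> //.
  by rewrite mem_pblock cyc_cover.
- have [Kr _ _] := root_ofP Kx; move: Kx Kr; rewrite !inE.
  by move=> /eqP ? /eqP.
- by rewrite eqxx.
Qed.

Lemma block_root_of o : o \in roots (root_of Pi) ->
  block (root_of Pi) o = pblock Pi (cyc o).
Proof.
rewrite inE => /andP[Ko /eqP ro]; apply/setP => c; apply/imsetP/idP.
  case=> x; rewrite inE => /andP[Kx]; rewrite -{1}ro => rx ->.
  by rewrite -root_of_eq // eq_sym.
move=> bc; have : c \in codom cyc.
  have : c \in cover Pi.
    apply/bigcupP; exists (pblock Pi (cyc o)) => //.
    by apply: pblock_mem; apply: cyc_cover.
  by rewrite cPi => /imsetP[x _ ->]; apply: codom_f.
case/mem_cyc_reps=> x Kx ec; exists x => //; rewrite inE Kx /=.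
by rewrite -[X in _ == X]ro eq_sym root_of_eq // -ec.
Qed.

Lemma blocks_root_of : blocks (root_of Pi) = Pi.
Proof.
have [RR _ _] := root_of_rooting.
apply/setP => B; apply/imsetP/idP => [[o oR ->]|BPi].
  rewrite block_root_of //; apply: pblock_mem; exact: cyc_cover.
have [c cB] : exists c, c \in B.
  by apply/set0Pn; case/and3P: PiP => _ _; apply: contraNneq => <-.
have cc : c \in codom cyc.
  have : c \in cover Pi by apply/bigcupP; exists B.
  by rewrite cPi => /imsetP[x _ ->]; apply: codom_f.
case/mem_cyc_reps: cc => x Kx ec; have [Kr br _] := root_ofP Kx.
have rr : root_of Pi x \in roots (root_of Pi) by rewrite inE Kr RR eqxx.
exists (root_of Pi x) => //; rewrite block_root_of // (same_pblock tPi br).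
by rewrite -ec (def_pblock tPi BPi cB).
Qed.

End FromPartition.

Section FromRooting.
Variable R : 'I_n -> 'I_n.
Hypothesis rR : rooting rho R.

Lemma rooting_reps x : x \in reps -> R x \in reps.
Proof.
have [_ _ Rr] := rR; move=> Kx; have [->//|/Rr[_ Rx]] := eqVneq (R x) x.
by rewrite inE Rx.
Qed.

Lemma rooting_roots x : x \in reps -> R x \in roots R.
Proof.
by have [RR _ _] := rR; move=> Kx; rewrite inE rooting_reps // RR eqxx.
Qed.

Lemma mem_block x o : x \in reps -> (cyc x \in block R o) = (R x == o).
Proof.
move=> Kx; apply/imsetP/idP => [[y]|Rx]; last by exists x; rewrite // inE Kx.
by rewrite inE => /andP[Ky Ry] /(cyc_inj Kx Ky)->.
Qed.

Lemma block_inj : {in roots R &, injective (block R)}.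
Proof.
move=> o o'; rewrite in_set => /andP[Ko /eqP Ro] _ e.
have := mem_block o Ko; rewrite e Ro eqxx mem_block // Ro.
by move/eqP.
Qed.

Lemma blocks_partition : partition (blocks R) (cyc @: setT).
Proof.
have [RR _ _] := rR; apply/and3P; split.
- apply/eqP/setP => c; apply/bigcupP/imsetP.
    by case=> _ /imsetP[o _ ->] /imsetP[x _ ->]; exists x.
  case=> y _ ec; have : c \in codom cyc by rewrite ec codom_f.
  case/mem_cyc_reps=> x Kx {}ec; exists (block R (R x)).
    by apply: imset_f; apply: rooting_roots.
  by rewrite ec mem_block.
- apply/trivIsetP => _ _ /imsetP[o _ ->] /imsetP[o' _ ->] noo.
  rewrite -setI_eq0; apply: contraNT noo => /set0Pn[c].
  rewrite inE => /andP[/imsetP[x]]; rewrite inE => /andP[Kx /eqP <-] ->.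
  by rewrite mem_block // => /eqP->.
- apply/negP => /imsetP[o]; rewrite in_set => /andP[Ko Ro] /esym/eqP.
  rewrite -subset0 => /fintype.subsetP/(_ (cyc o)); rewrite mem_block // Ro.
  by move/(_ isT); rewrite inE.
Qed.

Lemma pblock_blocks x : x \in reps -> pblock (blocks R) (cyc x) = block R (R x).
Proof.
move=> Kx; apply: def_pblock; last by rewrite mem_block.
  by case/and3P: blocks_partition.
by apply: imset_f; apply: rooting_roots.
Qed.

(** The least member of a block of [R] is its root by the definition of
    [rooting]. *)
Lemma root_of_blocks : root_of (blocks R) =1 R.
Proof.
have [RR lR Rr] := rR; move=> x; have [Kx|Kx] := boolP (x \in reps); last first.
  rewrite root_of_nrep //; apply/esym/eqP; apply: contraNT Kx => /Rr[rx _].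
  by rewrite inE rx.
have [Kr br mr] := root_ofP blocks_partition Kx.
move: br mr; rewrite pblock_blocks // mem_block // => /eqP rR' mr.
apply/val_inj/eqP; rewrite eqn_leq /= mr ?rooting_reps ?mem_block ?rooting_reps ?RR //.
by rewrite -rR' lR.
Qed.

Lemma card_blocks : #|blocks R| = #|roots R|.
Proof. by rewrite card_in_imset //; apply: block_inj. Qed.

Lemma card_block o : #|block R o| = #|[set x in reps | R x == o]|.
Proof.
rewrite card_in_imset // => x y; rewrite !inE => /andP[Kx _] /andP[Ky _].
by apply: cyc_inj; rewrite inE.
Qed.

End FromRooting.
End RootedPartitions.

(** * Counting the orbits of the model *)
Section ModelCount.
Import boot.finset GRing.Theory.
Local Open Scope ring_scope.
Variables (n m' p : nat).
Notation m := m'.+1.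
Notation A := 'I_m.
Notation X := ('I_n * A)%type.
Hypothesis p_dvd_m : (p %| m)%N.

Let P (c : A) := (p %| c)%N.

Lemma leq_compl (s1 s2 v1 v2 c k : nat) :
  (s1 + v1 + c = k)%N -> (s2 + v2 + c = k)%N -> (s1 <= s2)%N = (v2 <= v1)%N.
Proof. lia. Qed.

Lemma dvd_addr c d : P c -> P d -> P (c + d).
Proof. by move=> Pc Pd; rewrite /P /dvdn val_addr_mod. Qed.

Lemma val_sum (I : finType) (Q : pred I) (F : I -> A) :
  (\sum_(i | Q i) F i)%R = ((\sum_(i | Q i) (F i : nat)) %% m)%N :> nat.
Proof.
elim/big_rec2: _ => [|i x y _ e]; first by rewrite mod0n.
by rewrite [LHS]/= e modnDmr.
Qed.

Lemma inZpMn k : (inZp 1 : A) *+ k = inZp k.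
Proof.
elim: k => [|k IH]; first by apply/val_inj; rewrite /= mod0n.
by rewrite mulrS IH; apply/val_inj; rewrite /= modnDm.
Qed.

Variables (u : 'S_n) (a : 'I_n -> A).
Variables (Cy : {set {set 'I_n}}) (W : {set 'I_n} -> nat).
Hypothesis CyE : Cy = porbits u.
Hypothesis WE : forall x, W (porbit u x) = (\sum_(z in porbit u x) a z)%R.

Definition block_partition (Pi : {set {set {set 'I_n}}}) :=
  finset.partition Pi Cy && [forall B in Pi, p %| \sum_(c in B) W c]%N.

Definition block_value (Pi : {set {set {set 'I_n}}}) :=
  (#|Pi| + #|[set B in Pi | (m %| \sum_(c in B) W c)%N]%SET|)%N.

Definition max_partitions : {set {set {set {set 'I_n}}}} :=
  [set Pi | block_partition Pi &
   [forall Pi', block_partition Pi' ==> (block_value Pi' <= block_value Pi)%N]]%SET.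

Definition gcd_of_block (B : {set {set 'I_n}}) : nat :=
  \big[gcdn/m]_(c in B) W c.

Section WithReduction.
Variables (T0 : seq {perm X}) (rho : 'I_n -> 'I_n) (phi : 'I_n -> A).
Let w := blockweight a rho.
Hypotheses (rho_u : forall z, rho (u z) = rho z)
  (rho_porbit : forall z, rho z \in porbit u z)
  (phi0 : forall z, phi (rho z) = 0)
  (T0P : {in T0, forall t, exists x y,
           [/\ x != y, rho x = rho y & t = tr x y (phi y - phi x)]})
  (pT0 : (prods T0 * wr 1 w)%g = wr u a)
  (T0_reduce : forall T, shortest P T (wr u a) -> exists2 T',
          hurw T (T0 ++ T') &
          forall x, rho x != x -> {in T', forall t, fixes x t}).

Lemma rho_mem_porbit x z : z \in porbit u x -> rho z = rho x.
Proof.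
case/porbitP=> i ->; elim: i => [|i IH]; first by rewrite expg0 perm1.
by rewrite expgSr permM rho_u.
Qed.

Lemma rho_idem x : rho (rho x) = rho x.
Proof. exact: rho_mem_porbit. Qed.

Lemma porbit_rho x y : porbit u x = porbit u y <-> rho x = rho y.
Proof.
split=> [e|e]; first by apply: rho_mem_porbit; rewrite -e porbit_id.
have pr z : porbit u (rho z) = porbit u z.
  by apply/eqP; rewrite eq_porbit_mem.
by rewrite -pr e pr.
Qed.

Lemma w_nrep x : rho x != x -> w x = 0.
Proof.
move=> rx; rewrite /w /blockweight big_pred0 // => z; apply/eqP => rz.
by rewrite -rz rho_idem eqxx in rx.
Qed.

Lemma W_rep x : rho x = x -> W (porbit u x) = w x.
Proof.
move=> rx; rewrite WE /w /blockweight; congr (nat_of_ord _); apply: eq_bigl => z.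
apply/idP/eqP => [/rho_mem_porbit->//|rz].
by rewrite -eq_porbit_mem; apply/eqP/porbit_rho; rewrite rz.
Qed.

Lemma CyI : Cy = porbit u @: setT.
Proof.
rewrite CyE; apply/setP => c.
by apply/imsetP/imsetP => -[x _ ->]; exists x; rewrite ?inE.
Qed.

Let rep := reps rho.

Section OneRooting.
Variable R : 'I_n -> 'I_n.
Hypothesis rR : rooting rho R.

Lemma sum_block o (F : {set 'I_n} -> nat) :
  \sum_(c in block (porbit u) rho R o) F c =
  \sum_(x in rep | R x == o) F (porbit u x).
Proof.
rewrite big_imset; first by apply: eq_bigl => x; rewrite !inE.
move=> x y; rewrite !in_set => /andP[Kx _] /andP[Ky _].
by apply: (cyc_inj porbit_rho); rewrite in_set.
Qed.

Lemma blockweight_block o : o \in rep ->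
  blockweight w R o = ((\sum_(c in block (porbit u) rho R o) W c) %% m)%N :> nat.
Proof.
move=> Ko; rewrite sum_block /blockweight val_sum; congr (_ %% _)%N.
rewrite [LHS](bigID (mem rep)) /= [X in (_ + X)%N]big1 ?addn0.
  apply: eq_big => [x|x /andP[_]]; first by rewrite andbC.
  by rewrite inE => /eqP rx; rewrite W_rep.
by move=> x /andP[_]; rewrite inE => /w_nrep->.
Qed.

Lemma blockweight_nrep x : x \notin rep -> blockweight w R x = 0.
Proof.
move=> Kx; rewrite /blockweight big1 // => z /eqP Rz; apply: w_nrep.
have [_ _ Rr] := rR; have [ezx|ezx] := eqVneq z x.
  by move: Kx; rewrite inE ezx.
have /Rr[_] : R z != z by rewrite Rz eq_sym.
by rewrite Rz => rx; rewrite inE rx eqxx in Kx.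
Qed.

Lemma rooting_nrep x : x \notin rep -> R x = x.
Proof.
have [_ _ Rr] := rR; move=> Kx; apply/eqP; apply: contraNT Kx => /Rr[rx _].
by rewrite inE rx.
Qed.

(** Diagonal reflections of the group have an exponent divisible by p, hence the
    stars that are factorizations in G(m,p,n) are those of cycle partitions. *)
Lemma blockweight_P : (forall x, P (blockweight w R x)) <->
  [forall B in blocks (porbit u) rho R, p %| \sum_(c in B) W c]%N.
Proof.
have PE o : o \in rep -> P (blockweight w R o) =
    (p %| \sum_(c in block (porbit u) rho R o) W c)%N.
  by move=> Ko; rewrite /P blockweight_block // /dvdn modn_dvdm.
split=> [H|/forallP H x].
  apply/forallP => B; apply/implyP => /imsetP[o]; rewrite in_set => /andP[Ko _] ->.
  by rewrite -PE.
have [Kx|Kx] := boolP (x \in rep); last first.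
  by rewrite blockweight_nrep // /P dvdn0.
have [Rx|Rx] := boolP (R x == x).
  rewrite PE //; have /implyP := H (block (porbit u) rho R x); apply.
  by apply: imset_f; rewrite in_set Kx.
rewrite /blockweight big_pred0 ?/P ?dvdn0 // => z; apply/eqP => Rz.
by have [RR _ _] := rR; rewrite -Rz RR eqxx in Rx.
Qed.

(** Counting roots among all the indices, instead of the representatives only,
    adds to both counts the indices that are not representatives: they are
    alone in their blocks and have weight 0. *)
Lemma block_value_blocks :
  (block_value (blocks (porbit u) rho R) + #|~: rep|.*2 =
   #|[pred x | R x == x]| +
     #|[pred x | (R x == x) && (blockweight w R x == 0%R)]|)%N.
Proof.
rewrite /block_value (card_blocks porbit_rho).
have -> : [set B in blocks (porbit u) rho R | (m %| \sum_(c in B) W c)%N] =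
    block (porbit u) rho R @: [set o in roots rho R | blockweight w R o == 0].
  have zE o : o \in rep -> (blockweight w R o == 0) =
      (m %| \sum_(c in block (porbit u) rho R o) W c)%N.
    by move=> Ko; rewrite -val_eqE /= blockweight_block.
  apply/setP => B; rewrite inE; apply/andP/imsetP => [[/imsetP[o oR ->]]|[o]].
    rewrite -zE; last by move: oR; rewrite in_set => /andP[].
    by move=> b0; exists o => //; rewrite in_set oR.
  rewrite in_set => /andP[oR b0] ->; split; first exact: imset_f.
  by rewrite -zE //; move: oR; rewrite in_set => /andP[].
rewrite card_in_imset; last first.
  move=> o o'; rewrite in_set => /andP[oR _]; rewrite in_set => /andP[oR' _].
  exact: (block_inj porbit_rho) oR oR'.
rewrite -addnn addnACA; congr (_ + _)%N.
  rewrite -(cardID (mem rep) [pred x | R x == x]); congr (_ + _)%N.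
    by apply: eq_card => x; rewrite !inE andbC.
  apply: eq_card => x; rewrite !inE; have [//|rx /=] := boolP (rho x == x).
  by rewrite rooting_nrep ?eqxx // inE.
rewrite -(cardID (mem rep) [pred x | (R x == x) && _]); congr (_ + _)%N.
  by apply: eq_card => x; rewrite !inE -andbA andbC.
apply: eq_card => x; rewrite !inE; have [//|rx /=] := boolP (rho x == x).
by rewrite rooting_nrep ?eqxx ?blockweight_nrep ?eqxx // inE.
Qed.

Definition rgcd := block_gcd R (fun x => nat_of_ord (w x)) m.

Lemma gcd_of_blockE o : o \in rep ->
  gcd_of_block (block (porbit u) rho R o) = rgcd o.
Proof.
move=> Ko; apply/eqP; rewrite eqn_dvd; apply/andP; split.
  rewrite dvdn_big_gcdn big_gcdn_dvdm /=.
  apply/allP => x _; apply/implyP => Rx.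
  have [Kx|Kx] := boolP (x \in rep); last first.
    by rewrite w_nrep ?dvdn0 //; move: Kx; rewrite inE.
  rewrite -W_rep; last by move: Kx; rewrite inE => /eqP.
  apply: big_gcdn_dvd; rewrite ?mem_index_enum //.
  by rewrite (mem_block porbit_rho) // Rx.
rewrite dvdn_big_gcdn big_gcdn_dvdm /=.
apply/allP => c _; apply/implyP => /imsetP[x]; rewrite !inE => /andP[/eqP rx Rx] ->.
rewrite W_rep //.
by apply: (@big_gcdn_dvd _ (fun x => nat_of_ord (w x))); rewrite ?mem_index_enum.
Qed.

Lemma rgcd_gt0 o : (0 < rgcd o)%N.
Proof. by apply: dvdn_gt0 (big_gcdn_dvdm _ _ _ _). Qed.

Lemma rgcd_dvd o : (rgcd o %| m)%N.
Proof. exact: big_gcdn_dvdm. Qed.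

(** One representative of each class of labels modulo the gcd of the block. *)
Definition labels x : pred A := fun k => if R x == x then k == 0 else (k < rgcd (R x))%N.

Lemma card_labels x : #|labels x| = (if R x == x then 1 else rgcd (R x))%N.
Proof.
rewrite /labels; case: eqP => _; first by rewrite card1.
have rm : (rgcd (R x) <= m)%N by apply: dvdn_leq (rgcd_dvd _).
have wi : injective (widen_ord rm) by move=> i j /(congr1 val) /= /val_inj.
rewrite -[RHS]card_ord -[RHS](card_imset _ wi).
apply: eq_card => k; rewrite [LHS]/in_mem /=; apply/idP/imsetP => [kr|[j _ ->]].
  by exists (Ordinal kr) => //; apply/val_inj.
exact: (valP j).
Qed.

Lemma card_labellings : #|family labels| =
  (\prod_(B in blocks (porbit u) rho R) gcd_of_block B ^ (#|B| - 1))%N.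
Proof.
rewrite card_family foldrE big_map big_enum /=.
rewrite (eq_bigr _ (fun x _ => card_labels x)).
rewrite big_imset; last exact: (block_inj porbit_rho).
rewrite (bigID (fun x => R x == x)) /= big1 ?mul1n => [|x ->//].
rewrite (partition_big R (mem (roots rho R))) /=; last first.
  move=> x Rx; apply: rooting_roots => //.
  by apply: contraNT Rx => /rooting_nrep->.
apply: eq_bigr => o oR; have := oR; rewrite in_set => /andP[Ko Ro].
rewrite gcd_of_blockE // (card_block porbit_rho).
rewrite (eq_bigr (fun=> rgcd o)); last first.
  by move=> x /andP[/negPf-> /eqP->].
rewrite prod_nat_const; congr (_ ^ _)%N.
rewrite [in RHS](cardD1 o) in_set Ko Ro add1n subn1 /=.
apply: eq_card => x; rewrite [LHS]unfold_in /= [RHS]unfold_in /= in_set.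
have [->|xo] := eqVneq x o; first by rewrite Ro.
have [Rx|Rx] := eqVneq (R x) o; last by rewrite !andbF.
rewrite Rx eq_sym xo !andbT; apply/esym; apply: contraNT xo => Kx.
by rewrite -Rx rooting_nrep.
Qed.

Lemma normal_fact b : (forall x, P (blockweight w R x)) ->
  is_factorization P (T0 ++ star w R b) (wr u a).
Proof.
have [RR _ _] := rR; move=> PR; rewrite -pT0; apply: is_factorization_cat.
  by split=> // t /T0P[x [y [xy _ ->]]]; apply: ReflTr xy _.
exact: star_fact.
Qed.

Lemma normal_size b :
  (size (T0 ++ star w R b) + block_value (blocks (porbit u) rho R) +
    #|~: rep|.*2 = size T0 + n.*2)%N.
Proof.
rewrite size_cat -2!addnA; congr (_ + _)%N.
rewrite [X in (_ + X)%N]block_value_blocks; exact: star_size.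
Qed.

Lemma reduce_labels b : exists2 b' : {ffun 'I_n -> A},
  b' \in family labels & hurw (star w R b') (star w R b).
Proof.
have [RR _ _] := rR.
pose b' := [ffun x => if R x == x then 0 else inZp (b x %% rgcd (R x)) : A].
have lt_m x : (b x %% rgcd (R x) < m)%N.
  apply: leq_trans (ltn_pmod _ (rgcd_gt0 _)) _.
  by apply: dvdn_leq (rgcd_dvd _).
exists b'.
  apply/familyP => x; rewrite /labels [_ \in _]unfold_in ffunE.
  by case: eqP => // _; rewrite /= modn_small // ltn_mod rgcd_gt0.
apply: (@star_congr _ _ w R RR (inZp 1) (fun x => nat_of_ord (w x)) m) => //.
- by rewrite inZpMn; apply/val_inj; rewrite /= modnn.
- by move=> x; rewrite inZpMn valZpK.
move=> x Rx; exists (b x %/ rgcd (R x))%N; rewrite ffunE (negPf Rx) inZpMn.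
apply/val_inj; rewrite /= modnDm -/rgcd mulnC addnC -divn_eq modn_small //.
Qed.

End OneRooting.

Lemma reach_normal T : shortest P T (wr u a) -> exists R b,
  [/\ rooting rho R, forall x, P (blockweight w R x)
    & hurw T (T0 ++ star w R b)].
Proof.
move=> sT; have [T' TT' fT'] := T0_reduce sT.
have sT' : shortest P T' (wr 1 w).
  have := shortest_suffix (shortest_hurw TT' sT).
  suff -> : prods T' = wr 1 w by [].
  apply: (mulgI (prods T0)); rewrite pT0 -prods_cat -(hurw_prods TT').
  by case: sT => [[_ ->]].
have [|||||R [b [RR lR RK PR hR]]] := @diag_star _ _ P _ _ n w (mem rep) T' _ _ _ sT'.
- by rewrite /P dvdn0.
- exact: dvd_addr.
- by move=> x _; apply: ltn_ord.
- by move=> x nx; apply: w_nrep; move: nx; rewrite /= inE.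
- by move=> x nx; apply: fT'; move: nx; rewrite /= inE.
exists R, b; split=> //; last by apply: hurw_trans TT' (hurw_catl _ hR).
split=> // x /RK /andP[]; rewrite /rep /= !inE.
by move=> /eqP-> /eqP->.
Qed.

Definition normal_form (d : {set {set {set 'I_n}}} * {ffun 'I_n -> A}) :=
  T0 ++ star w (root_of (porbit u) rho d.1) d.2.

Definition normal_data := [set d : {set {set {set 'I_n}}} * {ffun 'I_n -> A} |
  (d.1 \in max_partitions) && (d.2 \in family (labels (root_of (porbit u) rho d.1)))].

Lemma mem_normal_data Pi b : ((Pi, b) \in normal_data) =
  (Pi \in max_partitions) && (b \in family (labels (root_of (porbit u) rho Pi))).
Proof. by rewrite in_set. Qed.

Lemma card_normal_data : #|normal_data| =
  (\sum_(Pi in max_partitions) \prod_(B in Pi) gcd_of_block B ^ (#|B| - 1))%N.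
Proof.
rewrite -sum1_card (eq_bigl (fun d => (d.1 \in max_partitions) &&
  (d.2 \in family (labels (root_of (porbit u) rho d.1))))); last first.
  by move=> d; rewrite inE.
rewrite -(pair_big_dep (fun Pi => Pi \in max_partitions)
  (fun Pi b => b \in family (labels (root_of (porbit u) rho Pi))) (fun _ _ => 1%N)) /=.
apply: eq_bigr => Pi; rewrite inE => /andP[/andP[pPi _] _].
rewrite CyI in pPi; have rR := root_of_rooting rho pPi.
rewrite sum1_card (card_labellings rR).
by rewrite (blocks_root_of porbit_rho rho_idem pPi).
Qed.

Lemma max_partition_data Pi : Pi \in max_partitions ->
  [/\ rooting rho (root_of (porbit u) rho Pi),
      blocks (porbit u) rho (root_of (porbit u) rho Pi) = Pi
    & forall x, P (blockweight w (root_of (porbit u) rho Pi) x)].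
Proof.
rewrite inE => /andP[/andP[pPi dPi] _]; rewrite CyI in pPi.
have rR := root_of_rooting rho pPi.
have bR := blocks_root_of porbit_rho rho_idem pPi.
by split=> //; apply/(blockweight_P rR); rewrite bR.
Qed.

(** The partition that a shortest factorization leads to has maximum value,
    because any other cycle partition also has a normal form, which is not
    shorter. *)
Lemma normal_complete T : shortest P T (wr u a) ->
  exists2 d, d \in normal_data & hurw T (normal_form d).
Proof.
move=> sT; have [R [b [rR PR hR]]] := reach_normal sT.
have [b' lb' hb'] := reduce_labels rR b.
pose Pi := blocks (porbit u) rho R.
have eR : root_of (porbit u) rho Pi = R.
  by apply/funext => x; apply: (root_of_blocks porbit_rho rho_idem rR).
exists (Pi, b'); last first.
  apply: hurw_trans hR _; apply: hurw_catl; rewrite /= eR.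
  exact: hurw_sym.
rewrite mem_normal_data eR lb' andbT inE; apply/andP; split.
  apply/andP; split; last exact/(blockweight_P rR).
  by rewrite CyI; apply: (blocks_partition porbit_rho rho_idem rR).
apply/forallP => Pi'; apply/implyP => /andP[pPi dPi]; rewrite CyI in pPi.
have rR' := root_of_rooting rho pPi.
have bR' := blocks_root_of porbit_rho rho_idem pPi.
have PR' : forall x, P (blockweight w (root_of (porbit u) rho Pi') x).
  by apply/(blockweight_P rR'); rewrite bR'.
have := sT.2 _ (normal_fact rR' (fun=> 0) PR'); rewrite (hurw_size hR).
rewrite -[in block_value Pi']bR'.
by rewrite (leq_compl (normal_size rR b) (normal_size rR' (fun=> 0))).
Qed.

(** A factorization of minimum length exists as soon as there is one, and it is
    equivalent to the normal form of some partition of maximum value, which has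
    the same length as this one. *)
Lemma normal_shortest d : d \in normal_data -> shortest P (normal_form d) (wr u a).
Proof.
case: d => Pi b; rewrite mem_normal_data => /andP[mPi _].
have [rR bR PR] := max_partition_data mPi.
have fN := normal_fact rR b PR.
split=> // T' fT'.
have exk : exists k, `[< exists2 T, is_factorization P T (wr u a) & size T = k >].
  by exists (size T'); apply/asboolP; exists T'.
case: (ex_minnP exk) => k /asboolP[T fT sTk] mk.
have sT : shortest P T (wr u a).
  by split=> // T'' fT''; rewrite sTk; apply: mk; apply/asboolP; exists T''.
have [[Pi1 b1]] := normal_complete sT; rewrite mem_normal_data => /andP[mPi1 _] h1.
have [rR1 bR1 _] := max_partition_data mPi1.
apply: leq_trans (_ : k <= _)%N; last by apply: mk; apply/asboolP; exists T'.
rewrite -sTk (hurw_size h1) /normal_form /=.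
rewrite (leq_compl (normal_size rR b) (normal_size rR1 b1)) bR bR1.
by move: mPi mPi1; rewrite !inE => /andP[_ /forallP/(_ Pi1)/implyP H] /andP[/H //].
Qed.

Lemma normal_inj : {in normal_data &, forall d d',
  hurw (normal_form d) (normal_form d') -> d = d'}.
Proof.
case=> Pi b [Pi' b']; rewrite !mem_normal_data => /andP[mPi lb] /andP[mPi' lb'] hh.
have [rR bR _] := max_partition_data mPi.
have [rR' bR' _] := max_partition_data mPi'.
have [/funext eR eb] := star_inj phi0 T0P w_nrep rR rR' hh.
have ePi : Pi = Pi' by rewrite -bR eR bR'.
congr (_, _) => //; apply/ffunP => x.
move: lb' => /familyP/(_ x); move: lb => /familyP/(_ x).
rewrite -eR /labels ![_ \in _]unfold_in; case: eqP => [_ /eqP-> /eqP->//|/eqP Rx].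
move=> l l'; have := eb x Rx; rewrite -/(rgcd _ _) !modn_small //.
exact: val_inj.
Qed.

End WithReduction.

(** The normal forms with canonical labels of the partitions of maximum value
    represent each Hurwitz orbit exactly once. *)
Lemma model_count : exists S : seq (seq {perm X}),
  [/\ size S = (\sum_(Pi in max_partitions)
                  \prod_(B in Pi) gcd_of_block B ^ (#|B| - 1))%N,
      uniq S, {in S, forall T, shortest P T (wr u a)},
      {in S &, forall T T', hurw T T' -> T = T'}
    & forall T, shortest P T (wr u a) -> exists2 T', T' \in S & hurw T T'].
Proof.
have [T0 [rho [phi [[r1 r2] [p1 p2] pT0 _ red]]]] := cycle_reduction dvd_addr u a.
pose D := normal_data rho; pose N := normal_form T0 rho.
have Ninj : {in D &, injective N}.
  move=> d d' Dd Dd' e; apply: (normal_inj r1 r2 p1 p2 Dd Dd').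
  by rewrite -/N e; apply: hurw_refl.
exists [seq N d | d <- enum D]; split.
- by rewrite size_map -cardE (card_normal_data r1 r2).
- rewrite map_inj_in_uniq ?enum_uniq // => d d'; rewrite !mem_enum.
  exact: Ninj.
- move=> T /mapP[d]; rewrite mem_enum => Dd ->.
  exact: (normal_shortest r1 r2 p2 pT0 red Dd).
- move=> T T' /mapP[d]; rewrite mem_enum => Dd -> /mapP[d'].
  rewrite mem_enum => Dd' -> hh.
  by rewrite (normal_inj r1 r2 p1 p2 Dd Dd' hh).
- move=> T sT; have [d Dd hd] := normal_complete r1 r2 p2 pT0 red sT.
  by exists (N d) => //; apply: map_f; rewrite mem_enum.
Qed.

End ModelCount.

(** * Monomial matrices *)
Section MatrixModel.
Import GRing.Theory Num.Theory.
Local Open Scope ring_scope.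
Variables (R : realType) (m' p n : nat).
Notation m := m'.+1.
Notation A := 'I_m.
Notation X := ('I_n * A)%type.
Hypothesis p_dvd_m : (p %| m)%N.
Notation mx := 'M[R[i]]_n.
Implicit Types (u v : 'S_n) (a b : 'I_n -> A) (x y z : 'I_n) (c d : A).
Implicit Types (h s t : {perm X}) (T : seq {perm X}).

Definition zeta (c : A) : R[i] := omega R m ^+ c.

Lemma zetaD c d : zeta (c + d) = zeta c * zeta d.
Proof. by rewrite /zeta expr_mod ?exprD // prim_expr_order // omega_prim. Qed.

Lemma zeta0 : zeta 0 = 1.
Proof. by []. Qed.

Lemma zeta_inj : injective zeta.
Proof.
move=> c d /eqP; rewrite (eq_prim_root_expr (omega_prim _ _)) // => /eqP.
by rewrite !modn_small // => /val_inj.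
Qed.

Lemma zeta_eq1 c : (zeta c == 1) = (c == 0).
Proof. by rewrite -zeta0 (inj_eq zeta_inj). Qed.

Lemma zetaNK c : zeta (- c) * zeta c = 1.
Proof. by rewrite -zetaD addNr. Qed.

Lemma zeta_neq0 c : zeta c != 0.
Proof.
apply/eqP => z0; have := zetaNK c; rewrite z0 mulr0 => /eqP.
by rewrite eq_sym oner_eq0.
Qed.

Lemma omegaX_inZp k : omega R m ^+ k = zeta (inZp k).
Proof. by rewrite /zeta /= expr_mod // prim_expr_order // omega_prim. Qed.

(** The matrix has its nonzero entry of row [i] in column [u i]. Reading rows
    rather than columns inverts the permutation, and in exchange the products of
    matrices and of permutations are taken in the same order. *)
Definition mx_of h : mx :=
  \matrix_(i, j) if j == (h (i, 0)).1 then zeta (h (i, 0)).2 else 0.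

Lemma mx_ofE u a i j :
  mx_of (wr u a) i j = if j == u i then zeta (a i) else 0.
Proof. by rewrite mxE wrE add0r. Qed.

Lemma mx_ofM h s : is_wr h -> is_wr s -> mx_of (h * s)%g = mx_of h *m mx_of s.
Proof.
move=> [u [a ->]] [v [b ->]]; apply/matrixP => i k.
rewrite wrM mx_ofE mxE (bigD1 (u i)) //= big1 => [|j ji]; last first.
  by rewrite mx_ofE (negPf ji) mul0r.
by rewrite !mx_ofE eqxx addr0 permM zetaD; case: eqP; rewrite ?mulr0.
Qed.

Lemma is_wrM h s : is_wr h -> is_wr s -> is_wr (h * s)%g.
Proof. by move=> [u [a ->]] [v [b ->]]; rewrite wrM; do 2 eexists. Qed.

Lemma is_wrV h : is_wr h -> is_wr h^-1%g.
Proof. by move=> [u [a ->]]; rewrite wrV; do 2 eexists. Qed.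

Lemma is_wr1 : is_wr (1 : {perm X})%g.
Proof. by exists 1%g, (fun=> 0); rewrite wr1. Qed.

Lemma mx_of1 : mx_of 1%g = 1%:M.
Proof.
apply/matrixP => i j; rewrite !mxE perm1 /= zeta0 eq_sym.
by case: eqP.
Qed.

Lemma mx_of_inj h s : is_wr h -> is_wr s -> mx_of h = mx_of s -> h = s.
Proof.
move=> [u [a ->]] [v [b ->]] e.
have euv x : u x = v x.
  apply/eqP; apply: contraT => uv; have := congr1 (fun M : mx => M x (u x)) e.
  rewrite !mx_ofE eqxx (negPf uv) => /eqP.
  by rewrite (negPf (zeta_neq0 _)).
apply: eq_wr => [|x]; first exact/permP.
have := congr1 (fun M : mx => M x (u x)) e.
by rewrite !mx_ofE euv eqxx => /zeta_inj.
Qed.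

Lemma mx_of_unit h : is_wr h -> mx_of h \in unitmx.
Proof.
move=> wh; have : mx_of h *m mx_of h^-1%g = 1%:M.
  by rewrite -mx_ofM ?mulgV ?mx_of1 //; apply: is_wrV.
by case/mulmx1_unit.
Qed.

Lemma mx_ofV h : is_wr h -> invmx (mx_of h) = mx_of h^-1%g.
Proof.
move=> wh; apply: (can_inj (mulKmx (mx_of_unit wh))).
rewrite mulmxV ?mx_of_unit // -mx_ofM ?mulgV ?mx_of1 //; exact: is_wrV.
Qed.

Lemma mx_ofJ h s : is_wr h -> is_wr s ->
  mx_of (h ^ s)%g = invmx (mx_of s) *m mx_of h *m mx_of s.
Proof.
move=> wh ws; have wV := is_wrV ws.
by rewrite mx_ofV // conjgE -mulmxA -mx_ofM // -mx_ofM //; apply: is_wrM.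
Qed.

Lemma mx_of_prods T : (forall t, t \in T -> is_wr t) ->
  is_wr (prods T) /\ \big[mulmx/1%:M]_(t <- [seq mx_of t | t <- T]) t = mx_of (prods T).
Proof.
elim: T => [_|t T IH wT].
  by rewrite prods_nil /= big_nil mx_of1; split=> //; apply: is_wr1.
have wt : is_wr t by apply: wT; rewrite mem_head.
have [|wp eT] := IH; first by move=> s sT; apply: wT; rewrite inE sT orbT.
rewrite map_cons big_cons eT prods_cons mx_ofM //.
by split=> //; apply: is_wrM.
Qed.

Lemma weight_product u a : \prod_i \prod_(j | mx_of (wr u a) i j != 0) mx_of (wr u a) i j
   = omega R m ^+ (\sum_i a i).
Proof.
rewrite -prodrXr; apply: eq_bigr => i _.
rewrite (big_pred1 (u i)) => [|j]; first by rewrite mx_ofE eqxx.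
by rewrite mx_ofE /=; case: (j =P u i) => _; rewrite ?zeta_neq0 ?eqxx.
Qed.

Lemma Gmpn_mx_of u a : (p %| \sum_i (a i : nat))%N -> Gmpn m p (mx_of (wr u a)).
Proof.
move=> pa; have e0 i j : (mx_of (wr u a) i j != 0) = (j == u i).
  by rewrite mx_ofE; case: (j =P u i) => _; rewrite ?zeta_neq0 ?eqxx.
apply/and3P; split.
- apply/andP; split; apply/forallP => i.
    rewrite -(card1 (u i)); apply/eqP; apply: eq_card => j.
    by rewrite !inE e0.
  rewrite -(card1 (u^-1 i)%g); apply/eqP; apply: eq_card => j.
  by rewrite !inE e0 eq_sym (can2_eq (permK u) (permKV u)).
- apply/forallP => i; apply/forallP => j; apply/implyP.
  rewrite e0 => /eqP->; rewrite mx_ofE eqxx /zeta -exprM mulnC exprM.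
  by rewrite (prim_expr_order (omega_prim _ _)) // expr1n.
rewrite weight_product -exprM -(prim_order_dvd (omega_prim _ _)) //.
by rewrite -{1}(divnK p_dvd_m) mulnC dvdn_mul.
Qed.

Definition column_perm (g : mx) : 'S_n := (monomial_perm g)^-1%g.
Definition row_exponent (g : mx) i : A := inZp (exponent m g (column_perm g i)).

Lemma mx_ofK (g : mx) : Gmpn m p g -> mx_of (wr (column_perm g) (row_exponent g)) = g.
Proof.
move=> gG; rewrite {3}(monomial_formE _ gG) //; apply/matrixP => i j.
rewrite mx_ofE mxE -omegaX_inZp /column_perm.
rewrite -(can2_eq (permK _) (permKV _)) eq_sym.
by case: eqP => // ->; rewrite permK.
Qed.

Lemma row_exponent_sum (g : mx) : Gmpn m p g -> (p %| \sum_i (row_exponent g i : nat))%N.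
Proof.
move=> gG; have : Gmpn m p (mx_of (wr (column_perm g) (row_exponent g))).
  by rewrite mx_ofK.
case/and3P=> _ _.
rewrite weight_product -exprM -(prim_order_dvd (omega_prim _ _)) //.
have p_gt0 : (0 < p)%N := dvdn_gt0 (ltn0Sn m') p_dvd_m.
have pm : (0 < m %/ p)%N by rewrite divn_gt0 //; apply: dvdn_leq.
by rewrite -{1}(divnK p_dvd_m) mulnC dvdn_pmul2r.
Qed.

End MatrixModel.

(** * Reflections of matrices and Hurwitz orbits *)
Section RankOne.
Import GRing.Theory.
Local Open Scope ring_scope.
Variables (F : fieldType) (n : nat).
Implicit Types N : 'M[F]_n.

Lemma rank1_minor N i j k l : \rank N = 1%N -> N i j * N k l = N i l * N k j.
Proof.
move=> rN; rewrite -(mulmx_base N) !mxE; move: (col_base N) (row_base N).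
by rewrite rN => c r; rewrite !big_ord1 mulrACA [r _ _ * _]mulrC mulrACA.
Qed.

Lemma rank1_rows N (i0 : 'I_n) : row i0 N != 0 ->
  (forall i, exists k, row i N = k *: row i0 N) -> \rank N = 1%N.
Proof.
move=> N0 rows; apply/eqP; rewrite eqn_leq; apply/andP; split.
  apply: leq_trans (rank_leq_row (row i0 N)); apply: mxrankS.
  by apply/row_subP => i; have [k ->] := rows i; apply: scalemx_sub.
apply: leq_trans (mxrankS (row_sub i0 N)).
by rewrite lt0n mxrank_eq0.
Qed.

Lemma rank_eigenspace1 N : (0 < n)%N ->
  ((\rank (eigenspace N^T 1)).+1 == n) = (\rank (N - 1%:M) == 1%N).
Proof.
move=> n0; rewrite /eigenspace mxrank_ker -[in RHS]mxrank_tr linearB /= tr_scalar_mx.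
by have := rank_leq_row (N^T - 1%:M); move: (\rank _) => r; clear -n0; lia.
Qed.

End RankOne.

Section ReflectionModel.
Import GRing.Theory Num.Theory.
Local Open Scope ring_scope.
Variables (R : realType) (m' p n : nat).
Notation m := m'.+1.
Notation A := 'I_m.
Notation X := ('I_n * A)%type.
Hypotheses (p_dvd_m : (p %| m)%N) (n_gt0 : (0 < n)%N).
Notation mx := 'M[R[i]]_n.
Implicit Types (u v : 'S_n) (a b : 'I_n -> A) (x y z : 'I_n) (c d : A).
Implicit Types (h s t : {perm X}) (T : seq {perm X}).

Let P (c : A) := (p %| c)%N.
Notation mx_of := (@mx_of R m' n).
Notation zeta := (@zeta R m').

Let N u a := mx_of (wr u a) - 1%:M.

Lemma displacementE u a i j :
  N u a i j = (if j == u i then zeta (a i) else 0) - (i == j)%:R.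
Proof. by rewrite mxE mx_ofE !mxE. Qed.

(** If [u x != x] then row [x] of [t - 1] is supported by [x] and [u x], and all
    the other rows are multiples of it; so the indices other than [x] and [u x]
    are fixed with exponent 0, and [u] exchanges [x] and [u x] with opposite
    exponents. If [u] is trivial then [t - 1] is diagonal. *)
Lemma rank1_is_reflection u a : (p %| \sum_i (a i : nat))%N ->
  \rank (N u a) = 1%N -> is_reflection P (wr u a).
Proof.
move=> pa r1; have minor i j k l := rank1_minor i j k l r1.
have off x z : z != u x -> z != x -> N u a x z = 0.
  by move=> zu zx; rewrite displacementE (negPf zu) eq_sym (negPf zx) subr0.
have moved x : u x != x -> N u a x x = -1.
  by move=> ux; rewrite displacementE eq_sym (negPf ux) eqxx sub0r.
have fixed x : u x = x -> N u a x x = zeta (a x) - 1.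
  by move=> ux; rewrite displacementE ux eqxx.
have [/existsP[x ux]|/existsPn u1] := boolP [exists x, u x != x]; last first.
  have eu x : u x = x by apply/eqP; have := u1 x; rewrite negbK.
  have [/existsP[x ax]|/existsPn a0] := boolP [exists x, a x != 0]; last first.
    have : N u a = 0.
      apply/matrixP => i j; rewrite displacementE eu mxE.
      have /eqP-> : a i == 0 by have := a0 i; rewrite negbK.
      by rewrite zeta0 eq_sym; case: eqP; rewrite ?subrr ?subr0.
    by move=> N0; move: r1; rewrite N0 mxrank0.
  have az z : z != x -> a z = 0.
    move=> zx; have xz : x != z by rewrite eq_sym.
    have := minor x x z z; rewrite (off x z) ?eu // mul0r => /eqP.
    rewrite mulf_eq0 !fixed ?eu // !subr_eq0 !zeta_eq1 (negPf ax) /=.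
    by move/eqP.
  have e : wr u a = dg x (a x).
    apply: eq_wr => [|z]; first by apply/permP => z; rewrite eu perm1.
    by have [->|zx] := eqVneq z x; rewrite ?mulr1n // az.
  apply: ReflDg ax _ e; rewrite /P.
  move: pa; rewrite (bigD1 x) //= big1 ?addn0 // => z zx.
  by rewrite az.
set y := u x; have yx : y != x by [].
have Nxy : N u a x y = zeta (a x).
  by rewrite displacementE eqxx eq_sym (negPf yx) subr0.
have others z : z != x -> z != y -> u z = z /\ a z = 0.
  move=> zx zy; have xz : x != z by rewrite eq_sym.
  have := minor x x z z; rewrite (off x z) // mul0r moved // => /eqP.
  rewrite mulf_eq0 oppr_eq0 oner_eq0 /=; have [uz|uz] := eqVneq (u z) z.
    by rewrite fixed // subr_eq0 zeta_eq1 => /eqP.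
  by rewrite moved // oppr_eq0 oner_eq0.
have uy : u y = x.
  have uyy : u y != y by rewrite {2}/y (inj_eq perm_inj).
  apply/eqP; apply: contraT => uyx; have [e _] := others _ uyx uyy.
  by rewrite (perm_inj e) eqxx in uyy.
have uyy : u y != y by rewrite uy eq_sym.
have ay : a y = - a x.
  have := minor x x y y; rewrite !moved // Nxy displacementE uy eqxx.
  rewrite (negPf yx) subr0 -zetaD mulrNN mulr1 => /esym/eqP.
  by rewrite zeta_eq1 addrC addr_eq0 => /eqP.
apply: (@ReflTr _ _ _ _ x y (a x)); first by rewrite eq_sym.
apply: eq_wr => [|z].
  apply/permP => z; case: tpermP => [->|->|/eqP zx /eqP zy] //.
  by have [] := others z zx zy.
have [->|zx] := eqVneq z x; first by rewrite eq_sym (negPf yx) subr0.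
have [->|zy] := eqVneq z y; first by rewrite mulr1n mulr0n sub0r.
by have [_ ->] := others z zx zy; rewrite !mulr0n subr0.
Qed.

Lemma is_reflection_rank1 h : is_reflection P h -> \rank (mx_of h - 1%:M) = 1%N.
Proof.
have rowE u a i j : row i (mx_of (wr u a) - 1%:M) 0 j =
    (if j == u i then zeta (a i) else 0) - (i == j)%:R.
  by rewrite mxE displacementE.
case=> [x y c xy ->|x c c0 Pc ->]; apply: (@rank1_rows _ _ _ x).
- apply/eqP => /rowP/(_ x)/eqP; rewrite rowE tpermL (negPf xy) eqxx mxE sub0r.
  by rewrite oppr_eq0 oner_eq0.
- have yx : y != x by rewrite eq_sym.
  move=> i; have [->|ix] := eqVneq i x; first by exists 1; rewrite scale1r.
  have [->|iy] := eqVneq i y; last first.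
    exists 0; apply/rowP => j; rewrite scale0r rowE mxE.
    rewrite tpermD 1?eq_sym // (negPf ix) (negPf iy) subr0 zeta0 eq_sym.
    by case: eqP => _; rewrite subrr.
  exists (- zeta (- c)); apply/rowP => j; rewrite rowE [RHS]mxE rowE.
  rewrite tpermR tpermL !eqxx (negPf xy) (negPf yx) !(mulr1n, mulr0n).
  rewrite sub0r subr0 mulrBr ![_ == j]eq_sym.
  have [->|jx] := eqVneq j x.
    by rewrite (negPf xy) mulr0 mulr1 subr0 sub0r opprK.
  have [_|_] := eqVneq j y; last by rewrite mulr0n mulr0 !subr0.
  by rewrite mulr0 mulNr zetaNK subr0 sub0r.
- apply/eqP => /rowP/(_ x)/eqP; rewrite rowE perm1 eqxx mxE mulr1n subr_eq0.
  by rewrite zeta_eq1 (negPf c0).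
move=> i; have [->|ix] := eqVneq i x; first by exists 1; rewrite scale1r.
exists 0; apply/rowP => j; rewrite scale0r rowE mxE perm1 (negPf ix) mulr0n.
by rewrite zeta0 eq_sym; case: eqP => _; rewrite subrr.
Qed.

Lemma dvd_sum a : (p %| \sum_i (a i : nat))%N = P (\sum_i a i).
Proof. by rewrite /P val_sum /dvdn modn_dvdm. Qed.

Lemma reflectionP (t : mx) :
  reflection m p t <-> exists2 h, is_reflection P h & t = mx_of h.
Proof.
rewrite /reflection rank_eigenspace1 //; split.
  case/andP=> tG /eqP r1; exists (wr (column_perm t) (row_exponent m' t)).
    apply: rank1_is_reflection; first exact: row_exponent_sum tG.
    by rewrite /N (mx_ofK tG).
  by rewrite (mx_ofK tG).
move=> [h rh ->]; rewrite (is_reflection_rank1 rh) eqxx andbT.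
case: rh => [x y c xy ->|x c c0 Pc ->]; apply: Gmpn_mx_of => //.
  by rewrite dvd_sum sumrB !sum_delta subrr /P dvdn0.
by rewrite dvd_sum sum_delta.
Qed.

Lemma factorizationP u a (ts : seq mx) :
  factorization m p (mx_of (wr u a)) ts <->
  exists2 T, is_factorization P T (wr u a) & ts = [seq mx_of t | t <- T].
Proof.
have wua : is_wr (wr u a) by exists u, a.
split=> [/andP[rts /eqP pts]|[T [rT pT] ->]]; last first.
  apply/andP; split.
    by apply/allP => _ /mapP[t /rT rt ->]; apply/reflectionP; exists t.
  have [|_ ->] := @mx_of_prods R _ _ T; first by move=> t /rT/is_reflection_wr.
  by rewrite pT.
have [T rT ets] : exists2 T, (forall t, t \in T -> is_reflection P t) &
    ts = [seq mx_of t | t <- T].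
  elim: ts rts {pts} => [_|t ts IH /= /andP[/reflectionP[h rh ->] /IH[T rT ->]]].
    by exists [::].
  by exists (h :: T) => // s; rewrite inE => /predU1P[->|/rT].
exists T => //; split=> //; move: pts; rewrite ets.
have [|wp ->] := @mx_of_prods R _ _ T; first by move=> t /rT/is_reflection_wr.
exact: mx_of_inj.
Qed.

Lemma shortest_factorizationP u a (ts : seq mx) :
  shortest_factorization m p (mx_of (wr u a)) ts <->
  exists2 T, shortest P T (wr u a) & ts = [seq mx_of t | t <- T].
Proof.
split=> [[/factorizationP[T fT ->] mT]|[T [fT mT] ->]].
  exists T => //; split=> // T' fT'.
  have /mT : factorization m p (mx_of (wr u a)) [seq mx_of t | t <- T'].
    by apply/factorizationP; exists T'.
  by rewrite !size_map.
split; first by apply/factorizationP; exists T.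
by move=> ts' /factorizationP[T' /mT + ->]; rewrite !size_map.
Qed.

Definition all_wr T := forall t, t \in T -> is_wr t.

Lemma all_wr_hurw T T' : hurw T T' -> all_wr T -> all_wr T'.
Proof.
move=> h wT; apply/(hurw_all (Q := @is_wr n _) _ _ h) => // s t ws wt.
  by rewrite conjgE; do !apply: is_wrM => //; apply: is_wrV.
by rewrite conjgE invgK; do !apply: is_wrM => //; apply: is_wrV.
Qed.

Lemma all_wr_cons t T : all_wr (t :: T) -> is_wr t /\ all_wr T.
Proof.
by move=> w; split=> [|s sT]; apply: w; rewrite ?mem_head // inE sT orbT.
Qed.

Lemma hurwitz_mx_of i T : all_wr T ->
  exists2 T', hurw T T' & hurwitz i [seq mx_of t | t <- T] = [seq mx_of t | t <- T'].
Proof.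
elim: i T => [|i IH] [|t T] /=; try by exists [::] => //; apply: hurw_refl.
  case: T => [|s T] /all_wr_cons[wt]; first by exists [:: t] => //; apply: hurw_refl.
  move=> /all_wr_cons[ws _]; exists (s :: (t ^ s)%g :: T).
    exact: (hurw_swap t s [::] T).
  by rewrite /= mx_ofJ.
move=> /all_wr_cons[wt /IH[T' h ->]]; exists (t :: T') => //.
exact: (hurw_catl [:: t]).
Qed.

Lemma hurwitz_inv_mx_of i T : all_wr T ->
  exists2 T', hurw T T' & hurwitz_inv i [seq mx_of t | t <- T] = [seq mx_of t | t <- T'].
Proof.
elim: i T => [|i IH] [|t T] /=; try by exists [::] => //; apply: hurw_refl.
  case: T => [|s T] /all_wr_cons[wt]; first by exists [:: t] => //; apply: hurw_refl.
  move=> /all_wr_cons[ws _]; exists ((s ^ t^-1)%g :: t :: T).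
    apply: hurw_sym; have := hurw_swap (s ^ t^-1)%g t [::] T.
    by rewrite /= conjgKV.
  rewrite /= mx_ofJ //; last exact: is_wrV.
  by rewrite -mx_ofV // invmxK.
move=> /all_wr_cons[wt /IH[T' h ->]]; exists (t :: T') => //.
exact: (hurw_catl [:: t]).
Qed.

Lemma braid_act_mx_of w T : all_wr T ->
  exists2 T', hurw T T' & braid_act w [seq mx_of t | t <- T] = [seq mx_of t | t <- T'].
Proof.
move=> wT; elim: w => [|[i e] w [T1 h1 e1]]; first by exists T => //; apply: hurw_refl.
have wT1 := all_wr_hurw h1 wT; rewrite /= e1; case: e.
  have [T' h ->] := hurwitz_inv_mx_of i wT1; exists T' => //.
  exact: hurw_trans h1 h.
have [T' h ->] := hurwitz_mx_of i wT1; exists T' => //.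
exact: hurw_trans h1 h.
Qed.

Lemma all_unit_mx_of T : all_wr T -> all [in unitmx] [seq mx_of t | t <- T].
Proof. by move=> wT; apply/allP => _ /mapP[t /wT wt ->]; apply: mx_of_unit. Qed.

Lemma braid_act_cat w1 w2 (ts : seq mx) :
  braid_act (w1 ++ w2) ts = braid_act w1 (braid_act w2 ts).
Proof. by rewrite /braid_act foldr_cat. Qed.

Lemma braid_act_inv w T : all_wr T ->
  exists w', braid_act w' (braid_act w [seq mx_of t | t <- T]) = [seq mx_of t | t <- T].
Proof.
move=> wT; elim: w => [|[i e] w [w' ew]]; first by exists [::].
exists (w' ++ [:: (i, ~~ e)]); rewrite braid_act_cat -[RHS]ew; congr braid_act.
have [T1 h1 e1] := braid_act_mx_of w wT.
have u1 := all_unit_mx_of (all_wr_hurw h1 wT).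
by rewrite /= e1; case: e; rewrite /= ?hurwitzK ?hurwitz_invK.
Qed.

Lemma hurwitz_cat i (ts ts' : seq mx) :
  hurwitz (size ts + i) (ts ++ ts') = ts ++ hurwitz i ts'.
Proof. by elim: ts => //= t ts ->. Qed.

Lemma hurw_braid_act T T' : hurw T T' -> all_wr T ->
  exists w, braid_act w [seq mx_of t | t <- T] = [seq mx_of t | t <- T'].
Proof.
elim=> {T T'} [T|T T' h IH|T T1 T2 h1 IH1 h2 IH2|s t T1 T2] wT.
- by exists [::].
- have wT' := all_wr_hurw (hurw_sym h) wT; have [w ew] := IH wT'.
  by have [w' ew'] := braid_act_inv w wT'; exists w'; rewrite -ew.
- have [w1 e1] := IH1 wT; have [w2 e2] := IH2 (all_wr_hurw h1 wT).
  by exists (w2 ++ w1); rewrite braid_act_cat e1.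
have ws : is_wr s by apply: wT; rewrite mem_cat !inE eqxx !orbT.
have wt : is_wr t by apply: wT; rewrite mem_cat !inE eqxx !orbT.
exists [:: (size T1, false)]; rewrite /= !map_cat /=.
rewrite -[size T1]addn0 -(size_map mx_of T1) hurwitz_cat /=.
by rewrite mx_ofJ.
Qed.

(** [mx_of] is injective on monomial elements, so braids and the moves of [hurw]
    give the same orbits. *)
Lemma hurwitz_orbit_eq T T' : all_wr T -> all_wr T' ->
  hurwitz_orbit [seq mx_of t | t <- T] = hurwitz_orbit [seq mx_of t | t <- T'] <->
  hurw T T'.
Proof.
have mxinj T1 T2 : all_wr T1 -> all_wr T2 ->
    [seq mx_of t | t <- T1] = [seq mx_of t | t <- T2] -> T1 = T2.
  elim: T1 T2 => [|t T1 IH] [|s T2] //= /all_wr_cons[w1 w2] /all_wr_cons[w3 w4].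
  by case=> /(mx_of_inj w1 w3)-> /(IH _ w2 w4)->.
move=> wT wT'; split=> [e|h].
  have : hurwitz_orbit [seq mx_of t | t <- T] [seq mx_of t | t <- T'].
    by rewrite e; exists [::].
  case=> w _; have [T1 h1 ->] := braid_act_mx_of w wT.
  by move/(mxinj _ _ (all_wr_hurw h1 wT) wT') => <-.
have sub T1 T2 : all_wr T1 -> all_wr T2 -> hurw T1 T2 ->
    (hurwitz_orbit [seq mx_of t | t <- T2] `<=`
     hurwitz_orbit [seq mx_of t | t <- T1])%classic.
  move=> w1 w2 h12 _ [w _ <-]; have [w' <-] := hurw_braid_act h12 w1.
  by exists (w ++ w') => //; rewrite braid_act_cat.
apply/seteqP; split; apply: sub => //; exact: hurw_sym.
Qed.

End ReflectionModel.

(** * The number of Hurwitz orbits *)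
Theorem theorem3p2 (R : realType) (m p n : nat)
    (m_gt0 : (0 < m)%N) (p_gt0 : (0 < p)%N) (n_gt0 : (0 < n)%N)
    (p_dvd_m : (p %| m)%N) (g : 'M[R[i]]_n) (gG : Gmpn m p g) :
  (hurwitz_orbits m p g #=
   `I_(\sum_(P in par_max m p g)
         \prod_(B in P) part_gcd m g B ^ (#|B| - 1)))%card.
Proof.
case: m m_gt0 p_dvd_m gG => // m' _ p_dvd_m gG.
set u := column_perm g; set a := row_exponent m' g.
have eg : mx_of R (wr u a) = g by apply: mx_ofK gG.
have CyE : cycles g = porbits u by rewrite /cycles /u /column_perm porbitsV.
have WE x : weight m'.+1 g (porbit u x) = (\sum_(z in porbit u x) a z)%R.
  rewrite /weight val_sum (reindex_inj (@perm_inj _ u)) /=.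
  rewrite -modn_summ; congr (_ %% _)%N; apply: eq_bigl => z.
  by rewrite -!eq_porbit_mem porbit_step.
have [S [sS uS shS injS cS]] := model_count p_dvd_m CyE WE.
have wS T : T \in S -> all_wr T.
  by move=> /shS[[rT _] _] t /rT/is_reflection_wr.
rewrite -[X in (_ #= `I_X)%card]sS card_eq_sym; apply/card_set_bijP.
exists (fun i => hurwitz_orbit [seq mx_of R t | t <- nth [::] S i]).
have nS i : (i < size S)%N -> nth [::] S i \in S by exact: mem_nth.
split.
- move=> i /= /nS/shS sT; exists [seq mx_of R t | t <- nth [::] S i] => //.
  by rewrite -eg; apply/(shortest_factorizationP p_dvd_m n_gt0); exists (nth [::] S i).
- move=> i j; rewrite !in_setE /= => iS jS.
  move/(hurwitz_orbit_eq R (wS _ (nS _ iS)) (wS _ (nS _ jS))).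
  move/(injS _ _ (nS _ iS) (nS _ jS))/eqP.
  by rewrite nth_uniq // => /eqP.
move=> _ [ts + <-]; rewrite -eg => /(shortest_factorizationP p_dvd_m n_gt0)[T sT ->].
have [T' T'S TT'] := cS T sT; exists (index T' S); first by rewrite /= index_mem.
rewrite nth_index //; apply/hurwitz_orbit_eq; [exact: wS| |exact: hurw_sym].
by case: sT => -[rT _] _ t /rT/is_reflection_wr.
Qed.
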